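(* Let $N\ge2$, let $K\subset\mathbb{R}^N$ be a convex body containing the origin in its interior, let $G\subset\mathbb{R}^N$ be a convex body with $C^2$-smooth boundary, let $x\in\partial G$, and denote by $\kappa_1(x),\dots,\kappa_{N-1}(x)$ the principal curvatures of $\partial G$ at $x$ with respect to the inward normal unit vector. Then $$\lim_{r\to0^+}\frac{\delta_K(x,r)-\delta_0(x)}{r}=-\frac{1}{2\,V(K)}\sum_{i=1}^{N-1}m_i(x)\,\kappa_i(x).$$ Therefore $$\delta_K(x,r)=\delta_0(x)-\delta_1(x)\,r+o(r)\quad\text{as } r\to0^+,\qquad \delta_1(x)=\frac{1}{2\,V(K)}\sum_{i=1}^{N-1}m_i(x)\,\kappa_i(x).$$
   Context: A convex body is a compact convex set with nonempty interior. $V$ denotes Lebesgue measure in $\mathbb{R}^N$, and $\delta_K(x,r)=V(G\cap(x+rK))/V(rK)$ for $x\in\mathbb{R}^N$, $r>0$. $\nu(x)$ denotes the inward unit normal to $\partial G$ at $x$; for a unit vector $u$, $H_u^+=\{y\in\mathbb{R}^N:\langle y,u\rangle\ge0\}$ and $\pi_u=\partial H_u^+=\{y:\langle y,u\rangle=0\}$. For $x\in\partial G$, $\delta_0(x)=V(K\cap H^+_{\nu(x)})/V(K)$. Let $e_1(x),\dots,e_{N-1}(x)$ be (orthonormal) principal directions of $\partial G$ at $x$ corresponding to $\kappa_1(x),\dots,\kappa_{N-1}(x)$ (with the sign convention that makes the principal curvatures of a convex body nonnegative), and $$m_i(x)=\int_{K\cap\pi_{\nu(x)}}\langle\xi,e_i(x)\rangle^2\,d\mathcal{H}^{N-1}_\xi,\quad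 i=1,\dots,N-1,$$ where $\mathcal{H}^{N-1}$ is $(N-1)$-dimensional Hausdorff measure. *)

(* Defs.v *)
From HB Require Import structures.
From mathcomp Require Import all_boot all_order all_algebra.
From mathcomp Require Import all_classical all_reals all_analysis.

Set Implicit Arguments.
Unset Strict Implicit.
Unset Printing Implicit Defensive.

Import Order.TTheory GRing.Theory Num.Theory.
Import numFieldNormedType.Exports.

Local Open Scope classical_set_scope.
Local Open Scope ring_scope.

(* R^n is 'rV[R]_n.  Its library norm is the sup norm (same topology and same
   notion of derivative as the Euclidean norm); the Euclidean structure is
   given by [inner] and [enorm]. *)

Section Euclid.
Context {R : realType} {n : nat}.
Implicit Types (u v : 'rV[R]_n) (C : set 'rV[R]_n).

Definition inner u v : R := \sum_i u 0 i * v 0 i.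

Definition enorm u : R := Num.sqrt (inner u u).

(* Only meant for bounded sets: [sup] is 0 on empty and on unbounded sets. *)
Definition diam C : R := sup [set enorm (u - v) | u in C & v in C].

Definition convex_body C := [/\ compact C, convex_set C & C° !=set0].

Definition boundary C := closure C `\` C°.

End Euclid.

(* The Borel sigma-algebra of R^n, generated by the coordinates (as the library
   does for tuples). *)

Definition measure_rV_display : measure_display -> measure_display.
Proof. exact. Qed.

Section measurable_rV.
Context {R : realType} {n : nat}.

Definition rV_coord (i : 'I_n) (v : 'rV[R]_n) : measurableTypeR R := v 0 i.

Let rV_set0 : g_sigma_preimage rV_coord set0.
Proof. exact: sigma_algebra0. Qed.

Let rV_setC A : g_sigma_preimage rV_coord A -> g_sigma_preimage rV_coord (~` A).
Proof. exact: sigma_algebraC. Qed.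

Let rV_bigcup (F : _^nat) : (forall i, g_sigma_preimage rV_coord (F i)) ->
  g_sigma_preimage rV_coord (\bigcup_i (F i)).
Proof. exact: sigma_algebra_bigcup. Qed.

HB.instance Definition _ :=
  @isMeasurable.Build (measure_rV_display default_measure_display)
    'rV[R]_n (g_sigma_preimage rV_coord) rV_set0 rV_setC rV_bigcup.

End measurable_rV.

Lemma measurable_rV_coord (R : realType) n (i : 'I_n) :
  measurable_fun [set: 'rV[R]_n] (rV_coord i).
Proof.
move=> _ Y mY; rewrite setTI; apply: sub_sigma_algebra => /=.
rewrite -bigcup_seq/=; exists i => /=; first by rewrite mem_index_enum.
by exists Y => //; rewrite setTI.
Qed.

Lemma measurable_fun_rV (R : realType) n d (T : measurableType d)
    (f : T -> 'rV[R]_n) :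
  (forall i, measurable_fun [set: T] (rV_coord i \o f)) ->
  measurable_fun [set: T] f.
Proof.
move=> mf _ A mA.
have h : g_sigma_preimage (fun i => rV_coord i \o f) `<=` @measurable _ T.
  apply: smallest_sub; first exact: sigma_algebra_measurable.
  case: n f mf {A mA} => [|k] f mf; first by rewrite big_ord0.
  rewrite -bigcup_mkord_ord; apply: bigcup_sub => i Ii.
  by move=> A [B mB <-]; exact: mf.
by apply: h; rewrite g_sigma_preimage_comp; exists A.
Qed.

(* [lebesgue_rV] is Lebesgue measure on R^n as the n-fold product measure:
   R^(n+1) is identified with R * R^n through [rV_cons]. *)

Section rV_cons.
Context {R : realType} {n : nat}.

Definition rV_cons (p : measurableTypeR R * 'rV[R]_n) : 'rV[R]_n.+1 :=
  row_mx (p.1)%:M p.2.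

Definition rV_uncons (v : 'rV[R]_n.+1) : measurableTypeR R * 'rV[R]_n :=
  (v 0 ord0, \row_i v 0 (lift ord0 i)).

Lemma rV_cons0 p : rV_cons p 0 ord0 = p.1.
Proof.
have -> : (ord0 : 'I_(1 + n)) = lshift n (0 : 'I_1) by exact/val_inj.
by rewrite [LHS]row_mxEl mxE eqxx.
Qed.

Lemma rV_consS p i : rV_cons p 0 (lift ord0 i) = p.2 0 i.
Proof.
have -> : lift (ord0 : 'I_(1 + n)) i = rshift 1 i by exact/val_inj.
by rewrite [LHS]row_mxEr.
Qed.

Lemma rV_consK : cancel rV_cons rV_uncons.
Proof.
move=> [t v]; rewrite /rV_uncons rV_cons0; congr pair.
by apply/rowP => i; rewrite mxE rV_consS.
Qed.

Lemma rV_unconsK : cancel rV_uncons rV_cons.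
Proof.
move=> v; apply/rowP => i; case: (unliftP ord0 i) => [j ->|->].
  by rewrite rV_consS mxE.
by rewrite rV_cons0.
Qed.

Lemma measurable_rV_cons : measurable_fun setT rV_cons.
Proof.
apply: measurable_fun_rV => i; case: (unliftP ord0 i) => [j ->|->].
  rewrite [X in measurable_fun _ X](_ : _ = rV_coord j \o snd).
    exact: (measurableT_comp (measurable_rV_coord j) measurable_snd).
  by apply/funext => p; rewrite /= /rV_coord rV_consS.
rewrite [X in measurable_fun _ X](_ : _ = fst); first exact: measurable_fst.
by apply/funext => p; rewrite /= /rV_coord rV_cons0.
Qed.

Lemma measurable_rV_uncons : measurable_fun setT rV_uncons.
Proof.
apply/measurable_fun_pair.
  exact: (measurable_rV_coord (ord0 : 'I_n.+1)).
apply: measurable_fun_rV => i.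
rewrite [X in measurable_fun _ X](_ : _ = rV_coord (lift ord0 i)).
  exact: measurable_rV_coord.
by apply/funext => v; rewrite /= /rV_coord mxE.
Qed.

End rV_cons.

Section lebesgue_succ.
Local Open Scope ereal_scope.
Context {R : realType} {n : nat}.
Variable mu : {sigma_finite_measure set 'rV[R]_n -> \bar R}.

Definition lebesgue_succ : set 'rV[R]_n.+1 -> \bar R :=
  pushforward (@lebesgue_measure R \x mu) rV_cons.

Let lebesgue_succ0 : lebesgue_succ set0 = 0.
Proof. by rewrite /lebesgue_succ /pushforward preimage_set0 measure0. Qed.

Let lebesgue_succ_ge0 A : 0 <= lebesgue_succ A.
Proof. by rewrite /lebesgue_succ /pushforward measure_ge0. Qed.

Let lebesgue_succ_sigma_additive : semi_sigma_additive lebesgue_succ.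
Proof.
have mc (A : set 'rV[R]_n.+1) : measurable A -> measurable (rV_cons @^-1` A).
  by move=> mA; rewrite -[X in measurable X]setTI; exact: measurable_rV_cons.
move=> F mF tF mUF; rewrite /lebesgue_succ /pushforward preimage_bigcup.
apply: measure_semi_sigma_additive; first by move=> k; exact: mc.
- apply/trivIsetP => /= i j _ _ ij; rewrite -preimage_setI.
  by move/trivIsetP : tF => /(_ _ _ _ _ ij) ->//; rewrite preimage_set0.
- by rewrite -preimage_bigcup; exact: mc.
Qed.

HB.instance Definition _ := isMeasure.Build _ _ _ lebesgue_succ
  lebesgue_succ0 lebesgue_succ_ge0 lebesgue_succ_sigma_additive.

Let lebesgue_succ_sigma_finite : sigma_finite setT lebesgue_succ.
Proof.
have /sigma_finiteP[F [TF ndF Foo]] := sigma_finiteT (@lebesgue_measure R).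
have /sigma_finiteP[G [TG ndG Goo]] := sigma_finiteT mu.
exists (fun k => rV_uncons @^-1` (F k `*` G k)).
  rewrite -preimage_bigcup -[LHS](@preimage_setT _ _ rV_uncons); congr preimage.
  rewrite -setXTT TF TG predeqE => -[x y]; split.
    move=> [/= [i _ Fix] [j _ Gjy]]; exists (maxn i j) => //; split.
    - by move: x Fix; exact/subsetPset/ndF/leq_maxl.
    - by move: y Gjy; exact/subsetPset/ndG/leq_maxr.
  by move=> [k _ []/= ? ?]; split; exists k.
move=> k; have [mF Fk] := Foo k; have [mG Gk] := Goo k; split.
  rewrite -[X in measurable X]setTI.
  by apply: measurable_rV_uncons => //; exact: measurableX.
rewrite /lebesgue_succ /pushforward -comp_preimage.
rewrite (_ : _ \o _ = id); last by apply/funext => p /=; exact: rV_consK.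
by rewrite preimage_id product_measure1E// lte_mul_pinfty// ge0_fin_numE.
Qed.

HB.instance Definition _ := Measure_isSigmaFinite.Build _ _ _ lebesgue_succ
  lebesgue_succ_sigma_finite.

End lebesgue_succ.

Fixpoint lebesgue_rV (R : realType) (n : nat) :
    {sigma_finite_measure set 'rV[R]_n -> \bar R} :=
  match n return {sigma_finite_measure set 'rV[R]_n -> \bar R} with
  | 0%N => dirac (0 : 'rV[R]_0)
  | k.+1 => lebesgue_succ (lebesgue_rV R k)
  end.

Definition vol {R : realType} {n : nat} (A : set 'rV[R]_n) : R :=
  fine (lebesgue_rV R n A).

(* m-dimensional Hausdorff measure on R^n, for m >= 1 (for m = 0 the empty set
   would be counted as a point).  [hausdorff0] is the sum of the m-th powers of
   the diameters, without any constant; [hausdorff] is normalized so that the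
   unit cube of R^m has measure 1, that is, so that H^m is Lebesgue measure
   on R^m.  It is given as a set function on all subsets of R^n and is a measure
   on the Borel sets, on which integrals against it are taken. *)

Section Hausdorff.
Context {R : realType}.
Local Open Scope ereal_scope.

Definition hausdorff_delta n (m : nat) (delta : R)
    (A : set 'rV[R]_n) : \bar R :=
  ereal_inf [set \sum_(k <oo) ((diam (C k)) ^+ m)%:E | C in
    [set C : (set 'rV[R]_n)^nat |
      (forall k u v, C k u -> C k v -> enorm (u - v) <= delta)%R /\
      A `<=` \bigcup_k C k]].

Definition hausdorff0 n (m : nat) (A : set 'rV[R]_n) : \bar R :=
  ereal_sup [set hausdorff_delta m delta A | delta in [set d : R | (0 < d)%R]].

Definition unit_cube {m} : set 'rV[R]_m :=
  [set v | forall i, (0 <= v 0%R i <= 1)%R].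

Definition hausdorff n (m : nat) (A : set 'rV[R]_n) : \bar R :=
  (fine (hausdorff0 m (unit_cube : set 'rV[R]_m)))^-1%:E * hausdorff0 m A.

End Hausdorff.

Section Hypersurface.
Context {R : realType} {N : nat}.
Implicit Types (S G K U : set 'rV[R]_N) (x y u v : 'rV[R]_N).

Definition C2_on U (phi : 'rV[R]_N -> R) := forall y, U y ->
  [/\ differentiable phi y,
      forall v, differentiable ('D_v phi) y &
      forall v w, {for y, continuous ('D_w ('D_v phi))}].

(* Near each boundary point, G is the superlevel set {phi >= 0} of a C^2
   function phi with nonvanishing differential. *)
Definition C2_boundary G := forall x, boundary G x ->
  exists (U : set 'rV[R]_N) (phi : 'rV[R]_N -> R),
    [/\ open U, U x, C2_on U phi,
        forall y, U y -> exists v, 'D_v phi y != 0 &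
        G `&` U = [set y | 0 <= phi y] `&` U].

Definition curve_through S x v (c : R -> 'rV[R]_N) :=
  [/\ c 0 = x, \forall t \near 0, S (c t) & is_derive (0 : R) 1 c v].

Definition tangent_vector S x v := exists c, curve_through S x v c.

Definition is_inward_unit_normal G x u :=
  [/\ inner u u = 1,
      forall v, tangent_vector (boundary G) x v -> inner u v = 0 &
      \forall t \near 0^'+, G (x + t *: u)].

(* Unique when the boundary of G is C^2 and x lies on it. *)
Definition nu G x : 'rV[R]_N := get (is_inward_unit_normal G x).

(* w is the value at the tangent vector v of the differential at x of the Gauss
   map [nu G] of the hypersurface [boundary G]. *)
Definition dnu G x v w := forall c,
  curve_through (boundary G) x v c -> is_derive (0 : R) 1 (nu G \o c) w.

(* The e i are an orthonormal family of eigenvectors of the shape operator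
   - d(nu), with eigenvalues kappa i; with the inward normal, this sign makes
   the principal curvatures of a convex body nonnegative. *)
Definition principal_curvatures_directions G x
    (kappa : 'I_N.-1 -> R) (e : 'I_N.-1 -> 'rV[R]_N) :=
  [/\ forall i, tangent_vector (boundary G) x (e i),
      forall i j, inner (e i) (e j) = (i == j)%:R &
      forall i, dnu G x (e i) (- (kappa i *: e i))].

Definition half_space u : set 'rV[R]_N := [set y | 0 <= inner y u].

Definition hyperplane u : set 'rV[R]_N := [set y | inner y u = 0].

Definition delta K G x (r : R) : R :=
  vol (G `&` [set x + r *: y | y in K]) / vol [set r *: y | y in K].

Definition delta0 K G x : R := vol (K `&` half_space (nu G x)) / vol K.

Definition moment K G x (e : 'rV[R]_N) : R :=
  fine (\int[hausdorff N.-1]_(xi in K `&` hyperplane (nu G x))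
          ((inner xi e) ^+ 2)%:E)%E.

Definition delta1 K G x (kappa : 'I_N.-1 -> R) (e : 'I_N.-1 -> 'rV[R]_N) : R :=
  1 / (2 * vol K) * \sum_i moment K G x (e i) * kappa i.

End Hypersurface.

(* Main.v *)
(* Near [x] write [G = {phi >= 0}], so that [nu] is the normalized gradient of [phi], and the second
   derivatives of [phi] at [x] along the [e i] form the diagonal matrix of the [- |grad phi| kappa i].
   By scaling, [delta K G x r] is the proportion of the [y] in [K] with [x + r y] in [G], and a Taylor
   expansion turns this condition into [<y, nu> + r w r y >= 0], where [w] is bounded and
   [w r (r s nu + v) --> q v = - (sum kappa i v_i ^ 2) / 2] as [r --> 0] for [v] tangent.  Hence the two sets
   compared by [delta - delta0] differ only in a layer of thickness [O(r)] along the hyperplane orthogonal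
   to [nu]; after the substitution [y = r s nu + v], dominated convergence gives
   [(delta - delta0) / r --> (\int q) / vol K] over the section of [K] by that hyperplane.
   The moments are taken with respect to the Hausdorff measure, which is Lebesgue measure in the
   orthonormal coordinates [e i]: it does not increase under 1-Lipschitz maps, and on R^m it is bounded by
   Lebesgue measure, with equality by comparing a set and its complement inside a cube. *)

Require Import Defs.
From HB Require Import structures.
From mathcomp Require Import all_boot all_order all_algebra.
From mathcomp Require Import all_classical all_reals all_analysis.
From mathcomp Require Import measurable_realfun lra ring.

Set Implicit Arguments.
Unset Strict Implicit.
Unset Printing Implicit Defensive.

Import Order.TTheory GRing.Theory Num.Theory.
Import numFieldNormedType.Exports.

Local Open Scope classical_set_scope.
Local Open Scope ring_scope.

(** * Lebesgue measure *)

(** All linear changes of variables (dilation, rotation, stretching of one axis) come from a single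
    Fubini argument, which reduces each of them to the choice of a test set whose preimage has known
    measure. [nu] is a chosen value and [dnu] is tested only along curves in the boundary, so
    curvature can be read off [phi] only once level sets are known to contain curves of every
    tangent velocity. In the stretched layer, pointwise convergence can fail in two places: on the
    graph s + q v = 0, which is null because its vertical fibres are single points, and over the
    points of the section that may not be interior to [K]. Convexity and the position of the origin
    enter there: the section is star-shaped, and its outer shell is null by scaling. [hausdorff] is
    handled throughout as a set function; its integral is compared with that of a push-forward of
    Lebesgue measure, using agreement on the measurable subsets of the section only. *)

Lemma measurable_box (R : realType) n (a b : 'I_n -> itv_bound R) :
  measurable [set v : 'rV[R]_n | forall i, v 0 i \in Interval (a i) (b i)].
Proof.
rewrite [X in measurable X](_ : _ = \bigcap_(i in [set: 'I_n]) (rV_coord i @^-1` [set` Interval (a i) (b i)])).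
  apply: fin_bigcap_measurable => // i _.
  by rewrite -[X in measurable X]setTI; apply: measurable_rV_coord => //; exact: measurable_itv.
by apply/seteqP; split => [v h i _|v h i]; [exact: h|exact: (h i I)].
Qed.

(** The sigma-algebra is generated by the coordinates, so an open set has to be exhausted by
    countably many boxes: those with rational centre and half-side 1/(k+1) that it contains. *)
Lemma open_measurable_rV (R : realType) n (U : set 'rV[R]_n) : open U -> measurable U.
Proof.
move=> oU.
pose B (q : 'rV[rat]_n * nat) : set 'rV[R]_n :=
  [set v | forall i, v 0 i \in `]ratr (q.1 0 i) - q.2.+1%:R^-1, ratr (q.1 0 i) + q.2.+1%:R^-1[].
have mB q : measurable (B q) by exact: measurable_box.
pose F k := if unpickle k is Some q then if `[< B q `<=` U >] then B q else set0 else set0.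
rewrite (_ : U = \bigcup_k F k).
  apply: bigcup_measurable => k _; rewrite /F.
  by case: unpickle => // q; case: ifP.
apply/seteqP; split => [v Uv|v [k _]]; last first.
  by rewrite /F; case: unpickle => // q; case: ifPn => // /asboolP; apply.
have /nbhs_ballP[e /= e0 ve] : nbhs v U by exact: open_nbhs_nbhs.
(* Two points of such a box differ by less than twice its half-side in each coordinate, hence the
   bound e / 2. *)
have [k ke] : exists k : nat, k.+1%:R^-1 < e / 2.
  have [k _ /(_ k (leqnn k))/= h] := near_infty_natSinv_lt (PosNum (divr_gt0 e0 (@ltr0n R 2))).
  by exists k.
have kp : 0 < k.+1%:R^-1 :> R by rewrite invr_gt0.
have /all_sig[q hq] : forall i, {q : rat | ratr q \in `]v 0 i - k.+1%:R^-1, v 0 i + k.+1%:R^-1[}.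
  by move=> i; apply/cid/rat_in_itvoo; rewrite ltrBlDr -addrA ltrDl addr_gt0.
exists (pickle (\row_i q i, k)) => //; rewrite /F pickleK.
set c := k.+1%:R^-1 in hq ke kp.
have Bv : B (\row_i q i, k) v.
  by move=> i /=; have := hq i; rewrite !in_itv/= mxE -/c => /andP[? ?]; apply/andP; split; lra.
case: ifPn => // /asboolP h; exfalso; apply: h => w Bw; apply: ve; split => // i j.
rewrite (ord1 i) /ball/= ltr_norml.
by have := Bw j; have := Bv j; rewrite !in_itv/= -/c => /andP[? ?] /andP[? ?]; apply/andP; split; lra.
Qed.

Lemma closed_measurable_rV (R : realType) n (A : set 'rV[R]_n) : closed A -> measurable A.
Proof. by move=> cA; rewrite -[A]setCK; apply: measurableC; apply: open_measurable_rV; exact: closed_openC. Qed.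

Lemma lebesgue_measure_shift (R : realType) (a : R) (A : set R) : measurable A ->
  lebesgue_measure ((fun t => t + a) @^-1` A) = lebesgue_measure A.
Proof.
move=> mA; have ms : measurable_fun [set: R] ((fun t => t + a) : measurableTypeR R -> measurableTypeR R).
  exact: measurable_funD.
apply/esym; rewrite -[RHS]/(pushforward lebesgue_measure ((fun t => t + a) : measurableTypeR R -> measurableTypeR R) A).
apply: lebesgue_measure_unique => // _ [[c d] _ <-] /=; rewrite /pushforward.
rewrite (_ : _ @^-1` _ = `]c - a, d - a]%classic); last first.
  by apply/seteqP; split => t /=; rewrite !in_itv/= ltrBlDr lerBrDr.
rewrite !lebesgue_measure_itv /= !lte_fin ltrD2r; case: ifP => // _.
by rewrite -!EFinB; congr EFin; lra.
Qed.

Lemma measurable_fun_addr (R : realType) n (w : 'rV[R]_n) :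
  measurable_fun setT (fun v : 'rV[R]_n => v + w).
Proof.
apply: measurable_fun_rV => i.
rewrite [X in measurable_fun _ X](_ : _ = rV_coord i \+ cst (w 0 i)).
  by apply: measurable_funD => //; exact: measurable_rV_coord.
by apply/funext => v; rewrite /rV_coord /= mxE.
Qed.

Lemma lebesgue_rV_shift (R : realType) n (w : 'rV[R]_n) A : measurable A ->
  lebesgue_rV R n ((fun v => v + w) @^-1` A) = lebesgue_rV R n A.
Proof.
elim: n w A => [|n IH] w A mA.
  rewrite (_ : _ @^-1` A = A)//; apply/seteqP; split => v /=; rewrite [w]thinmx0 addr0//.
rewrite /= /lebesgue_succ /pushforward.
pose s (p : measurableTypeR R * 'rV[R]_n) : measurableTypeR R * 'rV[R]_n :=
  (p.1 + w 0 ord0, p.2 + \row_i w 0 (lift ord0 i)).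
have ms : measurable_fun setT s.
  apply/measurable_fun_pair; first by apply: measurable_funD => //; exact: measurable_fst.
  exact: (measurableT_comp (measurable_fun_addr _) measurable_snd).
rewrite (_ : _ @^-1` (_ @^-1` A) = s @^-1` (rV_cons @^-1` A)); last first.
  rewrite /preimage; apply/funext => p /=; congr A.
  apply/rowP => i; case: (unliftP ord0 i) => [j ->|->].
    by rewrite mxE !rV_consS /s/= !mxE.
  by rewrite mxE !rV_cons0.
apply/esym; rewrite -[RHS]/(pushforward (@lebesgue_measure R \x lebesgue_rV R n)%E s _).
apply: product_measure_unique; last first.
  by rewrite -[X in measurable X]setTI; exact: measurable_rV_cons.
move=> B C mB mC; transitivity ((@lebesgue_measure R \x lebesgue_rV R n)%E (s @^-1` (B `*` C))) => //.
rewrite (_ : s @^-1` _ = ((fun t => t + w 0 ord0) @^-1` B) `*` ((fun v => v + \row_i w 0 (lift ord0 i)) @^-1` C));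
  last by apply/seteqP; split.
rewrite product_measure1E//; first by rewrite IH//; congr (_ * _)%E; exact: lebesgue_measure_shift.
  rewrite -[X in measurable X]setTI.
  have h : measurable_fun [set: R] ((fun t => t + w 0 ord0) : measurableTypeR R -> measurableTypeR R).
    exact: measurable_funD.
  exact: h.
rewrite -[X in measurable X]setTI; exact: measurable_fun_addr.
Qed.

Lemma measurable_prodset (R : realType) n (B : 'I_n -> set R) :
  (forall i, measurable (B i)) -> measurable [set v : 'rV[R]_n | forall i, B i (v 0 i)].
Proof.
move=> mB.
rewrite [X in measurable X](_ : _ = \bigcap_(i in [set: 'I_n]) (rV_coord i @^-1` B i)).
  apply: fin_bigcap_measurable => // i _.
  by rewrite -[X in measurable X]setTI; apply: measurable_rV_coord => //; exact: mB.
by apply/seteqP; split => [v h i _|v h i]; [exact: h|exact: (h i I)].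
Qed.

Lemma lebesgue_rV_prodset (R : realType) n (B : 'I_n -> set R) :
  (forall i, measurable (B i)) ->
  lebesgue_rV R n [set v : 'rV[R]_n | forall i, B i (v 0 i)] =
  (\prod_i @lebesgue_measure R (B i))%E.
Proof.
elim: n B => [|n IH] B mB.
  rewrite big_ord0 /= diracE.
  by rewrite (_ : _ \in _ = true)//; apply/mem_set => -[].
rewrite big_ord_recl /= /lebesgue_succ /pushforward.
rewrite (_ : rV_cons @^-1` _ = B ord0 `*` [set v : 'rV[R]_n | forall i, B (lift ord0 i) (v 0 i)]).
  rewrite product_measure1E; first by congr (_ * _)%E; apply: (IH (fun i => B (lift ord0 i))) => i; exact: mB.
    exact: mB.
  by apply: (measurable_prodset (B := fun i => B (lift ord0 i))) => i; exact: mB.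
apply/seteqP; split => [[t v] /= h|[t v] [/= h1 h2] i].
  split => [|i]; first by have := h ord0; rewrite rV_cons0.
  by have := h (lift ord0 i); rewrite rV_consS.
by case: (unliftP ord0 i) => [j ->|->]; rewrite ?rV_consS ?rV_cons0.
Qed.

Lemma lebesgue_rV_cube (R : realType) n (a : 'rV[R]_n) (s : R) (b1 b2 : bool) : 0 < s ->
  lebesgue_rV R n [set v : 'rV[R]_n | forall i,
    v 0 i \in Interval (BSide b1 (a 0 i)) (BSide b2 (a 0 i + s))] = (s ^+ n)%:E.
Proof.
move=> s0; rewrite (lebesgue_rV_prodset (B := fun i => [set` Interval (BSide b1 (a 0 i)) (BSide b2 (a 0 i + s))])).
  under eq_bigr do rewrite lebesgue_measure_itv /= lte_fin ltrDl s0 -EFinB addrAC subrr add0r.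
  by rewrite prodEFin prodr_const card_ord.
by move=> i; exact: measurable_itv.
Qed.

Lemma integral_xsection_ysection d1 d2 (T1 : measurableType d1) (T2 : measurableType d2)
    (R : realType) (m1 : {sigma_finite_measure set T1 -> \bar R})
    (m2 : {sigma_finite_measure set T2 -> \bar R}) (E : set (T1 * T2)) : measurable E ->
  (\int[m1]_x m2 [set y | E (x, y)] = \int[m2]_y m1 [set x | E (x, y)])%E.
Proof.
move=> mE; have := indic_fubini_tonelli m1 m2 mE.
rewrite indic_fubini_tonelli_FE// indic_fubini_tonelli_GE// => h.
under eq_integral do rewrite -[X in m2 X]/(pair _ @^-1` E) -xsectionE.
by rewrite h; apply: eq_integral => y _; rewrite /= ysectionE.
Qed.

(* Fubini on [{(x, y) | x \in A, g y - x \in Q}]: the push-forward of Lebesgue measure by [g] is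
   proportional to it, and the factor can be read off any [Q] of known measure. *)
Lemma lebesgue_rV_additive (R : realType) n (g : 'rV[R]_n -> 'rV[R]_n) (A Q : set 'rV[R]_n) :
  {morph g : u v / u + v} -> measurable_fun setT g -> (forall v, exists u, g u = v) ->
  measurable A -> measurable Q ->
  (lebesgue_rV R n A * lebesgue_rV R n (g @^-1` Q) =
   lebesgue_rV R n [set v | Q (- v)%R] * lebesgue_rV R n (g @^-1` A))%E.
Proof.
move=> gD mg gs mA mQ; set L := lebesgue_rV R n.
have mg1 B : measurable B -> measurable (g @^-1` B).
  by move=> mB; rewrite -[X in measurable X]setTI; exact: mg.
have mN : measurable_fun setT (fun v : 'rV[R]_n => - v).
  apply: measurable_fun_rV => i.
  rewrite [X in measurable_fun _ X](_ : _ = (fun v => - rV_coord i v)).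
    exact: (measurable_funN (measurable_rV_coord i)).
  by apply/funext => v; rewrite /rV_coord /= mxE.
have mD (f1 f2 : 'rV[R]_n * 'rV[R]_n -> 'rV[R]_n) : measurable_fun setT f1 ->
    measurable_fun setT f2 -> measurable_fun setT (fun p => f1 p + f2 p).
  move=> mf1 mf2; apply: measurable_fun_rV => i.
  rewrite [X in measurable_fun _ X](_ : _ = (rV_coord i \o f1) \+ (rV_coord i \o f2)).
    by apply: measurable_funD; apply: measurableT_comp => //; exact: measurable_rV_coord.
  by apply/funext => v; rewrite /rV_coord /= mxE.
have mpre (f : 'rV[R]_n * 'rV[R]_n -> 'rV[R]_n) B : measurable_fun setT f -> measurable B ->
    measurable (f @^-1` B).
  by move=> mf mB; rewrite -[X in measurable X]setTI; exact: mf.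
(* [E'] is [E] with the first variable translated by [g y]. Slicing [E] at fixed x gives the
   left-hand side, slicing [E'] at fixed x gives the right-hand side; translation invariance is used
   at fixed y for the passage between them. *)
pose E := [set p : 'rV[R]_n * 'rV[R]_n | A p.1 /\ Q (g p.2 - p.1)].
pose E' := [set p : 'rV[R]_n * 'rV[R]_n | A (p.1 + g p.2) /\ Q (- p.1)].
have mE : measurable E.
  apply: (@measurableI _ _ (fst @^-1` A) ((fun p => g p.2 - p.1) @^-1` Q)).
    by apply: mpre => //; exact: measurable_fst.
  apply: mpre => //; apply: mD; first exact: (measurableT_comp mg measurable_snd).
  exact: (measurableT_comp mN measurable_fst).
have mE' : measurable E'.
  apply: (@measurableI _ _ ((fun p => p.1 + g p.2) @^-1` A) ((fun p => - p.1) @^-1` Q)).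
    by apply: mpre => //; apply: mD; [exact: measurable_fst|exact: (measurableT_comp mg measurable_snd)].
  by apply: mpre => //; exact: (measurableT_comp mN measurable_fst).
transitivity (\int[L]_x L [set y | E (x, y)])%E.
  rewrite muleC -integral_cst// integral_mkcond; apply: eq_integral => x _.
  rewrite patchE; case: ifPn => [/set_mem Ax|/negP Ax].
    have [u gu] := gs (- x).
    rewrite -[LHS](lebesgue_rV_shift u); last exact: mg1.
    congr (L _); apply/seteqP; split => y /=; first by rewrite gD gu.
    by rewrite gD gu => -[].
  rewrite (_ : [set y | _] = set0) ?measure0// -subset0 => y [/= Ax' _].
  by apply: Ax; exact/mem_set.
rewrite integral_xsection_ysection//.
transitivity (\int[L]_y L [set x | E' (x, y)])%E.
  apply: eq_integral => y _.
  rewrite -[LHS](lebesgue_rV_shift (g y)).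
    congr (L _); apply/seteqP; split => x /=; rewrite /E /E' /=.
      by move=> [? h]; split => //; move: h; rewrite opprD addrCA subrr addr0.
    by move=> [? h]; split => //; rewrite opprD addrCA subrr addr0.
  rewrite (_ : [set x | _] = (fun x => (x, y)) @^-1` E)//.
  by rewrite -ysectionE; exact: measurable_ysection.
rewrite -integral_xsection_ysection//.
have mQN : measurable [set v | Q (- v)] by rewrite -[X in measurable X]setTI; exact: mN.
rewrite muleC -integral_cst// [RHS]integral_mkcond; apply: eq_integral => x _.
rewrite patchE; case: ifPn => [/set_mem Ax|/negP Ax].
  have [u gu] := gs x.
  rewrite -[RHS](lebesgue_rV_shift u); last exact: mg1.
  congr (L _); by apply/seteqP; split => y /=; rewrite /E'/= gD gu addrC => // -[].
rewrite (_ : [set y | _] = set0) ?measure0// -subset0 => y [/= _ Ax'].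
by apply: Ax; exact/mem_set.
Qed.

Lemma lebesgue_rV_symbox (R : realType) n (c : 'I_n -> R) : (forall i, 0 < c i) ->
  lebesgue_rV R n [set v : 'rV[R]_n | forall i, v 0 i \in `[- c i, c i]] = (\prod_i (2 * c i))%:E.
Proof.
move=> c0; rewrite (lebesgue_rV_prodset (B := fun i => [set` `[- c i, c i]])); last first.
  by move=> i; exact: measurable_itv.
rewrite -prodEFin; apply: eq_bigr => i _.
have := c0 i => ci; rewrite lebesgue_measure_itv /= lte_fin ifT; last by rewrite lt_neqAle; lra.
by rewrite -EFinB; congr EFin; ring.
Qed.

Lemma rV_symboxN (R : realType) n (c : 'I_n -> R) :
  [set v : 'rV[R]_n | [set v : 'rV[R]_n | forall i, v 0 i \in `[- c i, c i]] (- v)] =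
  [set v | forall i, v 0 i \in `[- c i, c i]].
Proof.
apply/seteqP; split => v /= h i; have := h i; rewrite !in_itv/= mxE => /andP[? ?];
  by apply/andP; split; lra.
Qed.

Lemma measurable_fun_linear_rV (R : realType) n m (M : 'M[R]_(n, m)) :
  measurable_fun setT (fun v : 'rV[R]_n => v *m M).
Proof.
apply: measurable_fun_rV => i.
rewrite [X in measurable_fun _ X](_ : _ = (fun v => \sum_j rV_coord j v * M j i)).
  apply: measurable_sum => j; apply: measurable_funM => //; exact: measurable_rV_coord.
by apply/funext => v; rewrite /rV_coord /= mxE.
Qed.

Lemma measurable_inner (R : realType) n d (T : measurableType d) (f g : T -> 'rV[R]_n) :
  measurable_fun setT f -> measurable_fun setT g -> measurable_fun setT (fun v => inner (f v) (g v)).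
Proof.
move=> mf mg; apply: measurable_sum => i; apply: measurable_funM.
  exact: (measurableT_comp (measurable_rV_coord i) mf).
exact: (measurableT_comp (measurable_rV_coord i) mg).
Qed.

Lemma mule_pinj (R : realType) (c : R) (x y : \bar R) : 0 < c ->
  (c%:E * x = c%:E * y)%E -> x = y.
Proof.
move=> c0 h; have p : {mono *%E c%:E : x y / x <= y}%E by apply: lee_pmul2l; rewrite ?lte_fin.
by apply/eqP; rewrite eq_le -(p x y) -(p y x) h lexx.
Qed.

Lemma lebesgue_rV_scale (R : realType) n (s : R) (A : set 'rV[R]_n) : 0 < s -> measurable A ->
  lebesgue_rV R n [set s *: v | v in A] = ((s ^+ n)%:E * lebesgue_rV R n A)%E.
Proof.
move=> s0 mA; have s1 : s != 0 by rewrite gt_eqF.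
pose g (v : 'rV[R]_n) := v *m (s^-1)%:M.
have gE v : g v = s^-1 *: v by rewrite /g mul_mx_scalar.
have -> : [set s *: v | v in A] = g @^-1` A.
  apply/seteqP; split => [_ [v Av <-]|v /=]; rewrite /= gE; first by rewrite scalerA mulVf// scale1r.
  by move=> Av; exists (s^-1 *: v) => //; rewrite scalerA mulfV// scale1r.
pose Q := [set v : 'rV[R]_n | forall i, v 0 i \in `[- 1, 1]].
have := @lebesgue_rV_additive R n g A Q; rewrite (rV_symboxN (fun=> 1)).
rewrite (lebesgue_rV_symbox (fun=> @ltr01 R)).
have -> : g @^-1` Q = [set v | forall i, v 0 i \in `[- s, s]].
  by apply/seteqP; split => v /= h i; have := h i; rewrite gE mxE !in_itv/= -!ler_norml normrM
    gtr0_norm ?invr_gt0// ler_pdivrMl// mulr1.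
rewrite (lebesgue_rV_symbox (fun=> s0)) !prodr_const !card_ord mulr1 exprMn EFinM => h.
apply: (@mule_pinj _ (2 ^+ n)); first exact: exprn_gt0.
rewrite -h.
- by rewrite [LHS]muleC muleA.
- by move=> u v; rewrite /g mulmxDl.
- exact: measurable_fun_linear_rV.
- by move=> v; exists (s *: v); rewrite gE scalerA mulVf// scale1r.
- exact: mA.
- exact: (measurable_box (fun=> BLeft (-1)) (fun=> BRight 1)).
Qed.

(** The test set is the Euclidean unit ball: it is symmetric and invariant under [M], so the factor
    is 1 as soon as the ball has positive finite measure. *)
Lemma lebesgue_rV_rot (R : realType) n (M : 'M[R]_n) (A : set 'rV[R]_n) :
  M *m M^T = 1%:M -> measurable A ->
  lebesgue_rV R n ((fun v => v *m M) @^-1` A) = lebesgue_rV R n A.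
Proof.
move=> MM mA; pose g (v : 'rV[R]_n) := v *m M.
pose Q := [set v : 'rV[R]_n | inner v v <= 1].
have mQ : measurable Q.
  rewrite (_ : Q = (fun v => inner v v) @^-1` [set` `]-oo, 1]]); last first.
    by apply/seteqP; split => v; rewrite /Q/= in_itv.
  have mi : measurable_fun setT (fun v : 'rV[R]_n => inner v v) by exact: measurable_inner.
  by rewrite -[X in measurable X]setTI; apply: mi => //; exact: measurable_itv.
have gQ : g @^-1` Q = Q.
  have E v : inner (g v) (g v) = inner v v.
    have E1 (w : 'rV[R]_n) : inner w w = (w *m w^T) 0 0.
      by rewrite mxE; apply: eq_bigr => i _; rewrite mxE.
    by rewrite !E1 /g trmx_mul mulmxA -(mulmxA v) MM mulmx1.
  by apply/seteqP; split => v; rewrite /Q/= E.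
have QN : [set v | Q (- v)] = Q.
  have E (v : 'rV[R]_n) : inner (- v) (- v) = inner v v.
    by apply: eq_bigr => i _; rewrite mxE mulrNN.
  by apply/seteqP; split => v; rewrite /Q/= E.
have := @lebesgue_rV_additive R n g A Q; rewrite gQ QN.
have n0 : 0 < (n.+1%:R : R)^-1 by rewrite invr_gt0.
have n1 : (n.+1%:R : R)^-1 <= 1 by rewrite invf_le1// ler1n.
(* The cube of half-side 1/(n+1) lies in the ball, since each of the n squares is at most 1/(n+1);
   taking n+1 instead of n also covers n = 0. *)
have Q0 : (0 < lebesgue_rV R n Q)%E.
  apply: (@lt_le_trans _ _ (lebesgue_rV R n [set v | forall i, v 0 i \in `[- n.+1%:R^-1, n.+1%:R^-1]])).
    by rewrite (lebesgue_rV_symbox (fun=> n0)) lte_fin prodr_gt0// => i _; rewrite mulr_gt0.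
  apply: le_measure; rewrite ?inE//.
    exact: (measurable_box (fun=> BLeft _) (fun=> BRight _)).
  move=> v /= h; rewrite /Q/=.
  apply: (@le_trans _ _ (\sum_(i < n) n.+1%:R^-1)).
    apply: ler_sum => i _; have := h i; rewrite in_itv/= -ler_norml => vi.
    rewrite -expr2 -real_normK ?num_real// expr2.
    by rewrite (le_trans (ler_pM _ _ vi vi))// ler_piMr// ltW.
  rewrite sumr_const card_ord -[leLHS]mulr_natl ler_pdivrMr// mul1r ler_nat; exact: leqnSn.
have Qoo : (lebesgue_rV R n Q < +oo)%E.
  apply: (@le_lt_trans _ _ (lebesgue_rV R n [set v | forall i, v 0 i \in `[- 1, 1]])); last first.
    by rewrite (lebesgue_rV_symbox (fun=> ltr01)) ltry.
  apply: le_measure; rewrite ?inE//.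
    exact: (measurable_box (fun=> BLeft _) (fun=> BRight _)).
  move=> v; rewrite /Q/= => h i; rewrite in_itv/= -ler_norml.
  have : v 0 i * v 0 i <= 1.
    apply: le_trans h; rewrite /inner (bigD1 i)//= lerDl sumr_ge0// => j _; exact: sqr_ge0.
  by rewrite -expr2 -real_normK ?num_real// expr_le1.
move: Q0 Qoo; case: (lebesgue_rV R n Q) => [q||]//; rewrite lte_fin => q0 _ h.
apply: (mule_pinj q0); rewrite -h.
- exact: muleC.
- by move=> u v; rewrite /g mulmxDl.
- exact: measurable_fun_linear_rV.
- by move=> v; exists (v *m M^T); rewrite /g -mulmxA (mulmx1C MM) mulmx1.
- exact: mA.
- exact: mQ.
Qed.

Definition scale_head (R : realType) n (r : R) (v : 'rV[R]_n.+1) : 'rV[R]_n.+1 :=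
  \row_i (if i == ord0 then r * v 0 i else v 0 i).

Lemma measurable_scale_head (R : realType) n (r : R) :
  measurable_fun setT (@scale_head R n r).
Proof.
apply: measurable_fun_rV => i; case: (eqVneq i ord0) => [->|i0].
  rewrite [X in measurable_fun _ X](_ : _ = (fun v => r * rV_coord ord0 v)).
    by apply: measurable_funM => //; exact: measurable_rV_coord.
  by apply/funext => v; rewrite /rV_coord /= mxE.
rewrite [X in measurable_fun _ X](_ : _ = rV_coord i); first exact: measurable_rV_coord.
by apply/funext => v; rewrite /rV_coord /= mxE (negPf i0).
Qed.

(** This factor [r] is what the quotient by [r] in the limit cancels. It is read off the cube of
    half-side 1, whose preimage is a box with first half-side 1/r. *)
Lemma lebesgue_rV_scale_head (R : realType) n (r : R) (A : set 'rV[R]_n.+1) :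
  0 < r -> measurable A ->
  lebesgue_rV R n.+1 A = (r%:E * lebesgue_rV R n.+1 (scale_head r @^-1` A))%E.
Proof.
move=> r0 mA.
pose c (i : 'I_n.+1) : R := if i == ord0 then r^-1 else 1.
have c0 i : 0 < c i by rewrite /c; case: ifP => // _; rewrite invr_gt0.
pose Q := [set v : 'rV[R]_n.+1 | forall i, v 0 i \in `[- 1, 1]].
have := @lebesgue_rV_additive R n.+1 (scale_head r) A Q; rewrite (rV_symboxN (fun=> 1)).
rewrite (lebesgue_rV_symbox (fun=> @ltr01 R)).
have -> : scale_head r @^-1` Q = [set v | forall i, v 0 i \in `[- c i, c i]].
  apply/seteqP; split => v /= h i; have := h i; rewrite !mxE /c !in_itv/= -!ler_norml;
    by case: ifP => // _; rewrite normrM gtr0_norm// -ler_pdivlMl// mulr1.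
rewrite (lebesgue_rV_symbox c0) !big_ord_recl /= /c eqxx => h.
apply: (@mule_pinj _ (2 / r * 2 ^+ n)); first by rewrite mulr_gt0// ?exprn_gt0// divr_gt0.
move: h; under eq_bigr do rewrite /=.
rewrite !mulr1 !prodr_const !card_ord => h; rewrite muleC h.
- rewrite muleA -EFinM; congr (_%:E * _)%E; field; exact: lt0r_neq0.
- move=> u v; apply/rowP => i; rewrite !mxE; case: ifP => // _; exact: mulrDr.
- exact: measurable_scale_head.
- move=> v; exists (scale_head r^-1 v); apply/rowP => i; rewrite !mxE; case: eqVneq => [->|//].
  by rewrite mulrA mulfV ?mul1r// gt_eqF.
- exact: mA.
- exact: (measurable_box (fun=> BLeft _) (fun=> BRight _)).
Qed.

Lemma lebesgue_rV_bounded (R : realType) n (M : R) (A : set 'rV[R]_n) :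
  measurable A -> (forall v, A v -> forall i, `|v 0 i| <= M) -> (lebesgue_rV R n A < +oo)%E.
Proof.
move=> mA AM.
(* [M] may be negative when [A] is empty; [|M| + 1] is a positive half-side in every case. *)
apply: (@le_lt_trans _ _ (lebesgue_rV R n [set v | forall i, v 0 i \in `[- (`|M| + 1), `|M| + 1]])).
  apply: le_measure; rewrite ?inE//.
    exact: (measurable_box (fun=> BLeft _) (fun=> BRight _)).
  move=> v /AM h i; rewrite in_itv/= -ler_norml (le_trans (h i))// (le_trans (ler_norm M))//.
  by rewrite lerDl.
by rewrite lebesgue_rV_symbox ?ltry// => _; rewrite ltr_wpDl.
Qed.

(** * Hausdorff measure *)

Lemma inner_sqr (R : realType) n (v : 'rV[R]_n) : inner v v = \sum_i (v 0 i) ^+ 2.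
Proof. by apply: eq_bigr => i _; rewrite expr2. Qed.

Lemma inner_ge0 (R : realType) n (v : 'rV[R]_n) : 0 <= inner v v.
Proof. by rewrite inner_sqr sumr_ge0// => i _; exact: sqr_ge0. Qed.

Lemma enorm_ge0 (R : realType) n (v : 'rV[R]_n) : 0 <= enorm v.
Proof. exact: sqrtr_ge0. Qed.

Lemma coord_le_enorm (R : realType) n (v : 'rV[R]_n) i : `|v 0 i| <= enorm v.
Proof.
rewrite -sqrtr_sqr ler_sqrt ?inner_ge0// inner_sqr (bigD1 i)//= lerDl.
by rewrite sumr_ge0// => j _; exact: sqr_ge0.
Qed.

Lemma enorm_le_coord (R : realType) n (v : 'rV[R]_n) (d : R) : (0 < n)%N ->
  (forall i, `|v 0 i| <= d) -> enorm v <= n%:R * d.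
Proof.
move=> n0 h; have d0 : 0 <= d by rewrite (le_trans _ (h (Ordinal n0))).
have nd : 0 <= n%:R * d by rewrite mulr_ge0.
rewrite -(ger0_norm nd) -sqrtr_sqr ler_sqrt ?sqr_ge0// inner_sqr.
apply: (@le_trans _ _ (\sum_(i < n) d ^+ 2)).
  by apply: ler_sum => i _; rewrite -real_normK ?num_real// lerXn2r// nnegrE.
rewrite sumr_const card_ord -[leLHS]mulr_natl exprMn ler_wpM2r ?sqr_ge0//.
by rewrite -natrX ler_nat -{1}[n]expn1 leq_pexp2l.
Qed.

Lemma enormZ (R : realType) n (s : R) (v : 'rV[R]_n) : enorm (s *: v) = `|s| * enorm v.
Proof.
rewrite /enorm -sqrtr_sqr -sqrtrM ?sqr_ge0//; congr Num.sqrt.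
by rewrite !inner_sqr mulr_sumr; apply: eq_bigr => i _; rewrite mxE exprMn.
Qed.

Section diameter.
Context {R : realType} {n : nat}.
Implicit Types (C D : set 'rV[R]_n) (d : R).

(** Some bound [d] must be known beforehand, because [sup] takes the value 0 on unbounded sets. *)
Lemma enorm_le_diam C d u v : (forall u v, C u -> C v -> enorm (u - v) <= d) ->
  C u -> C v -> enorm (u - v) <= diam C.
Proof.
move=> Cd Cu Cv; apply: ub_le_sup; last by exists u => //; exists v.
by exists d => _ [a Ca [b Cb <-]]; exact: Cd.
Qed.

Lemma diam0 : diam (set0 : set 'rV[R]_n) = 0.
Proof. by rewrite /diam (_ : image2 _ _ _ = set0) ?sup0// -subset0 => x [u []]. Qed.

Lemma diam_le C d : 0 <= d -> (forall u v, C u -> C v -> enorm (u - v) <= d) -> diam C <= d.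
Proof.
move=> d0 Cd; have [->|/set0P[u Cu]] := eqVneq C set0.
  by rewrite diam0.
apply: ge_sup; first by exists (enorm (u - u)), u => //; exists u.
by move=> _ [a Ca [b Cb <-]]; exact: Cd.
Qed.

Lemma diam_ge0 C : 0 <= diam C.
Proof.
have [h|h] := pselect (has_sup [set enorm (u - v) | u in C & v in C]); last first.
  by rewrite /diam sup_out.
have [[_ [a Ca [b Cb _]]] hu] := h.
by rewrite (le_trans (enorm_ge0 (a - b)))//; apply: ub_le_sup => //; exists a => //; exists b.
Qed.

End diameter.

(* Sets all of whose pairwise distances are at most [d] form a semiring of sets,
   so that [hausdorff_delta] is an instance of the library's [mu_ext]. *)
Section hausdorff_delta_outer.
Context {R : realType} {n : nat}.

Definition small_display : R -> measure_display. Proof. by move=> _; exact: default_measure_display. Qed.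
(** An alias indexed by [d], so that the same space can carry one semiring of sets for each [d]. *)
Definition small_rV (d : R) : Type := 'rV[R]_n.

Definition small_set (d : R) (C : set 'rV[R]_n) :=
  forall u v, C u -> C v -> enorm (u - v) <= d.

Variable d : R.
HB.instance Definition _ := Pointed.on (small_rV d).

Let small0 : small_set d (set0 : set (small_rV d)). Proof. by []. Qed.
Let smallI : setI_closed (small_set d : set (set (small_rV d))).
Proof. by move=> A B hA hB u v [Au _] [Av _]; exact: hA. Qed.
Let smallD : semi_setD_closed (small_set d : set (set (small_rV d))).
Proof.
move=> A B hA hB; exists [set (A `\` B)%classic]; split.
- exact: finite_set1.
- by move=> _ -> u v [Au _] [Av _]; exact: hA.
- by rewrite bigcup_set1.
- by move=> X Y -> ->.
Qed.

HB.instance Definition _ := @isSemiRingOfSets.Build (small_display d) (small_rV d)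
  (small_set d) small0 smallI smallD.
End hausdorff_delta_outer.

Section hausdorff_outer.
Context {R : realType} {n : nat}.
Variable m : nat.
Implicit Types (A B : set 'rV[R]_n) (d : R).
Local Open Scope ereal_scope.

Let mu_ge0 (C : set 'rV[R]_n) : 0 <= ((diam C) ^+ m)%:E.
Proof. by rewrite lee_fin exprn_ge0// diam_ge0. Qed.

Lemma hausdorff_delta_ge0 d A : 0 <= hausdorff_delta m d A.
Proof. exact: (@mu_ext_ge0 _ (@small_rV R n d) R (fun C => ((diam (C : set 'rV[R]_n)) ^+ m)%:E)). Qed.

Lemma le_hausdorff_delta d A B : A `<=` B -> hausdorff_delta m d A <= hausdorff_delta m d B.
Proof. exact: (@le_mu_ext _ (@small_rV R n d) R (fun C => ((diam (C : set 'rV[R]_n)) ^+ m)%:E)). Qed.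

Lemma hausdorff_delta_sigma_subadditive d :
  sigma_subadditive (@hausdorff_delta R n m d).
Proof. exact: (@mu_ext_sigma_subadditive _ (@small_rV R n d) R (fun C => ((diam (C : set 'rV[R]_n)) ^+ m)%:E)). Qed.

Lemma hausdorff_delta_le_hausdorff0 d A : (0 < d)%R -> hausdorff_delta m d A <= hausdorff0 m A.
Proof. by move=> d0; apply: ereal_sup_ubound; exists d. Qed.

Lemma hausdorff0_ge0 A : 0 <= hausdorff0 m A.
Proof. exact: le_trans (hausdorff_delta_ge0 1 A) (hausdorff_delta_le_hausdorff0 _ ltr01). Qed.

Lemma le_hausdorff0 A B : A `<=` B -> hausdorff0 m A <= hausdorff0 m B.
Proof.
move=> AB; apply: ge_ereal_sup => _ [d /= d0 <-].
exact: le_trans (le_hausdorff_delta d AB) (hausdorff_delta_le_hausdorff0 _ d0).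
Qed.

Lemma hausdorff0_sigma_subadditive : sigma_subadditive (@hausdorff0 R n m).
Proof.
move=> F; apply: ge_ereal_sup => _ [d /= d0 <-].
apply: (le_trans (hausdorff_delta_sigma_subadditive d F)); apply: lee_nneseries => k *.
  exact: hausdorff_delta_ge0.
exact: hausdorff_delta_le_hausdorff0.
Qed.

Lemma hausdorff_delta_small d A : (0 < m)%N -> small_set d A ->
  hausdorff_delta m d A <= ((diam A) ^+ m)%:E.
Proof.
move=> m0 Ad; apply: ereal_inf_lbound => /=.
(* The cover is [A] padded with empty sets; these contribute 0 ^ m, which vanishes because m > 0. *)
exists (fun k => if k == 0%N then A else set0).
  split; last by move=> v Av; exists 0%N.
  by case=> [|k] u v //; exact: Ad.
rewrite nneseries_recl//= eseries0 ?adde0// => -[|k]// _ _ /=.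
by rewrite diam0 expr0n eqn0Ngt m0.
Qed.

Lemma hausdorff0_set0 : (0 < m)%N -> hausdorff0 m (set0 : set 'rV[R]_n) = 0.
Proof.
move=> m0; apply/eqP; rewrite eq_le hausdorff0_ge0 andbT.
apply: ge_ereal_sup => _ [d /= d0 <-].
by rewrite (le_trans (hausdorff_delta_small m0 _))// diam0 expr0n eqn0Ngt m0.
Qed.

End hausdorff_outer.

(** A cover of [A] at scale d / s is mapped to a cover of the image at scale d with diameters
    multiplied by at most s. Each covering set is first cut down to [A], where alone the Lipschitz
    bound is available. *)
Lemma hausdorff0_lipschitz (R : realType) n p m (f : 'rV[R]_n -> 'rV[R]_p) (s : R)
    (A : set 'rV[R]_n) : 0 < s ->
  (forall u v, A u -> A v -> enorm (f u - f v) <= s * enorm (u - v)) ->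
  (hausdorff0 m (f @` A) <= (s ^+ m)%:E * hausdorff0 m A)%E.
Proof.
move=> s0 fs; apply: ge_ereal_sup => _ [d /= d0 <-].
have sm0 : 0 < s ^+ m by rewrite exprn_gt0.
apply: (@le_trans _ _ ((s ^+ m)%:E * hausdorff_delta m (d / s) A)%E); last first.
  apply: lee_wpmul2l; first by rewrite lee_fin ltW.
  by apply: hausdorff_delta_le_hausdorff0; rewrite divr_gt0.
rewrite -lee_pdivrMl//; apply: le_ereal_inf_tmp => _ [C [Cd AC] <-].
rewrite lee_pdivrMl// -nneseriesZl; last by move=> k _; rewrite lee_fin exprn_ge0// diam_ge0.
pose D k := f @` (C k `&` A).
have Dsm k u v : D k u -> D k v -> exists2 w, (enorm (u - v) <= s * enorm (w.1 - w.2)) & C k w.1 /\ C k w.2.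
  by move=> [a [Ca Aa] <-] [b [Cb Ab] <-]; exists (a, b) => //=; exact: fs.
apply: (@le_trans _ _ (\sum_(k <oo) ((diam (D k)) ^+ m)%:E)%E).
  apply: ereal_inf_lbound; exists D => //; split.
    move=> k u v Du Dv; have [[a b] /= h [Ca Cb]] := Dsm _ _ _ Du Dv.
    by rewrite (le_trans h)// mulrC -ler_pdivlMr// (Cd k).
  by move=> _ [a Aa <-]; have [k _ Ca] := AC _ Aa; exists k => //; exists a.
apply: lee_nneseries => k *; first by rewrite lee_fin exprn_ge0// diam_ge0.
rewrite -EFinM lee_fin -exprMn lerXn2r ?nnegrE ?mulr_ge0 ?diam_ge0//; first exact: ltW.
apply: diam_le; first by rewrite mulr_ge0 ?diam_ge0// ltW.
move=> u v Du Dv; have [[a b] /= h [Ca Cb]] := Dsm _ _ _ Du Dv.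
rewrite (le_trans h)// ler_pM2l//; exact: (enorm_le_diam (Cd k)).
Qed.

(** * Grids of half-open cubes of side 1/(d+1) *)

Lemma floor_div (R : archiRealDomainType) (x : R) (k : nat) : (0 < k)%N ->
  forall y : R, y * k%:R = x -> Num.floor y = (Num.floor x %/ k)%Z.
Proof.
move=> k0 y yx; apply: floor_def.
have kz : (k : int) != 0 by rewrite eqz_nat -lt0n.
have k0' : 0 < k%:R :> R by rewrite ltr0n.
have := divz_eq (Num.floor x) k; have := modz_ge0 (Num.floor x) kz.
have : (Num.floor x %% k < k)%Z by rewrite ltz_pmod// ltz_nat.
set q := (Num.floor x %/ k)%Z; set r := (Num.floor x %% k)%Z => r1 r0 E.
apply/andP; split.
  rewrite -(ler_pM2r k0') yx -[k%:R]/((k%:Z)%:~R) -intrM.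
  by apply: le_trans (floor_le_tmp x); rewrite ler_int E lerDl.
rewrite -(ltr_pM2r k0') yx -[k%:R]/((k%:Z)%:~R) -intrM -floor_lt_int E.
by rewrite mulrDl mul1r ltrD2l.
Qed.

Section grid.
Context {R : realType} {n : nat}.
Implicit Types (d : nat) (Z : set 'rV[int]_n).

Definition gfloor d (v : 'rV[R]_n) : 'rV[int]_n := \row_i Num.floor (v 0 i * d.+1%:R).

(** Two grids have a common refinement, obtained by multiplying the inverse meshes; the index d
    stands for the mesh 1/(d+1), hence the predecessor. *)
Lemma gfloor_refine d1 d2 : exists h, forall v, gfloor d1 v = h (gfloor (d1.+1 * d2.+1).-1 v).
Proof.
exists (fun z : 'rV[int]_n => \row_i (z 0%R i %/ d2.+1%N)%Z) => v; apply/rowP => i; rewrite !mxE.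
by apply: floor_div => //; rewrite -mulrA -natrM.
Qed.

Lemma measurable_gfloor d Z : measurable (gfloor d @^-1` Z).
Proof.
rewrite (_ : _ @^-1` _ = \bigcup_k (if unpickle k is Some z then
    (if z \in Z then gfloor d @^-1` [set z] else set0) else set0)).
  apply: bigcup_measurable => k _; case: unpickle => // z; case: ifP => // _.
  rewrite (_ : _ @^-1` _ = [set v : 'rV[R]_n | forall i, v 0 i \in `[(z 0 i)%:~R / d.+1%:R, (z 0 i + 1)%:~R / d.+1%:R[]).
    exact: (measurable_box (fun i => BLeft ((z 0 i)%:~R / d.+1%:R : R)) (fun i => BLeft ((z 0 i + 1)%:~R / d.+1%:R : R))).
  apply/seteqP; split => v /=.
    move=> <- i; rewrite mxE in_itv/= ler_pdivrMr// ltr_pdivlMr//.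
    by rewrite floor_le_tmp -floor_lt_int ltrDl.
  move=> h; apply/rowP => i; rewrite mxE; apply: floor_def.
  by have := h i; rewrite in_itv/= ler_pdivrMr// ltr_pdivlMr.
apply/seteqP; split => [v Zv|v [k _]].
  by exists (pickle (gfloor d v)) => //; rewrite pickleK mem_set.
by case: unpickle => // z; case: ifPn => // /set_mem zZ /= ->.
Qed.

(** A union of cells is countable, so an estimate on single cells sums up: subadditivity serves for
    [Phi], additivity for Lebesgue measure. *)
Lemma le_lebesgue_gfloor (Phi : set 'rV[R]_n -> \bar R) (C : R) d Z : 0 <= C ->
  sigma_subadditive Phi -> (forall A, 0 <= Phi A)%E -> (Phi set0 = 0)%E ->
  (forall z, Phi (gfloor d @^-1` [set z]) <= C%:E * lebesgue_rV R n (gfloor d @^-1` [set z]))%E ->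
  (Phi (gfloor d @^-1` Z) <= C%:E * lebesgue_rV R n (gfloor d @^-1` Z))%E.
Proof.
move=> C0 Phis Phi0 Phi00 h.
(* [pickle_inv] lists every cell exactly once, which makes the sets [F k] pairwise disjoint. *)
pose F k := if pickle_inv k is Some z then
    (if z \in Z then gfloor d @^-1` [set z] else set0) else set0.
have FE k : F k = set0 \/ exists2 z, pickle_inv k = Some z & F k = gfloor d @^-1` [set z].
  rewrite /F; case E : (pickle_inv k) => [z|]; last by left.
  by case: ifP => _; [right; exists z|left].
have -> : gfloor d @^-1` Z = \bigcup_k F k.
  apply/seteqP; split => [v Zv|v [k _]].
    by exists (pickle (gfloor d v)) => //; rewrite /F pickleK_inv mem_set.
  by rewrite /F; case: pickle_inv => // z; case: ifPn => // /set_mem zZ /= ->.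
rewrite measure_bigcup//; last 2 first.
- by move=> k _; case: (FE k) => [->|[z _ ->]] //; exact: measurable_gfloor.
- apply/trivIsetP => i j _ _ ij; rewrite -subset0 => v [].
  case: (FE i) => [->//|[z zi ->]]; case: (FE j) => [->//|[z' zj ->]] /= vz vz'.
  move/eqP: ij; apply; move: vz vz' => -> zz'.
  have := @pickle_invK 'rV[int]_n i; rewrite zi /= => <-; have := @pickle_invK 'rV[int]_n j; rewrite zj /= => <-.
  by rewrite zz'.
rewrite -nneseriesZl; last by move=> k _; exact: measure_ge0.
under [leRHS]eq_eseriesl do rewrite in_setT.
apply: (le_trans (Phis F)); apply: lee_nneseries => k // _.
by case: (FE k) => [->|[z _ ->]]; rewrite ?measure0 ?Phi00 ?mule0.
Qed.
End grid.

(** * Lebesgue measure as the outer measure of the ring of grid sets *)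

Section grid_ring.
Context {R : realType} {n : nat}.

Definition grid_rV : Type := 'rV[R]_n.

(** The mesh varies from set to set, and [Z] may be infinite; common refinements make these sets a
    ring. *)
Definition grid_set (A : set 'rV[R]_n) := exists d Z, A = gfloor d @^-1` Z.

Lemma measurable_grid_set (A : set 'rV[R]_n) : grid_set A -> measurable A.
Proof. by move=> [d [Z ->]]; exact: measurable_gfloor. Qed.

Lemma grid_set2 A B : grid_set A -> grid_set B ->
  exists d Z1 Z2, A = gfloor d @^-1` Z1 /\ B = gfloor d @^-1` Z2.
Proof.
move=> [d1 [Z1 ->]] [d2 [Z2 ->]]; have [h1 E1] := @gfloor_refine R n d1 d2.
have [h2 E2] := @gfloor_refine R n d2 d1; rewrite mulnC in E2.
exists (d1.+1 * d2.+1).-1, (h1 @^-1` Z1), (h2 @^-1` Z2).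
by split; apply/seteqP; split => v /=; rewrite ?E1 ?E2.
Qed.

HB.instance Definition _ := Pointed.on grid_rV.

Let grid_set0 : grid_set (set0 : set grid_rV).
Proof. by exists 0%N, set0; rewrite preimage_set0. Qed.

Let grid_setU : setU_closed (grid_set : set (set grid_rV)).
Proof.
move=> A B hA hB; have [d [Z1 [Z2 [-> ->]]]] := grid_set2 hA hB.
by exists d, (Z1 `|` Z2); rewrite preimage_setU.
Qed.

Let grid_setD : setD_closed (grid_set : set (set grid_rV)).
Proof.
move=> A B hA hB; have [d [Z1 [Z2 [-> ->]]]] := grid_set2 hA hB.
by exists d, (Z1 `\` Z2); apply/seteqP; split.
Qed.

HB.instance Definition _ := @isRingOfSets.Build default_measure_display grid_rV
  grid_set grid_set0 grid_setU grid_setD.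

Definition lebesgue_grid (A : set grid_rV) : \bar R := lebesgue_rV R n (A : set 'rV[R]_n).

Let lebesgue_grid0 : (lebesgue_grid set0 = 0)%E. Proof. exact: measure0. Qed.
Let lebesgue_grid_ge0 A : (0 <= lebesgue_grid A)%E. Proof. exact: measure_ge0. Qed.
Let lebesgue_grid_sigma : semi_sigma_additive lebesgue_grid.
Proof.
move=> F mF tF mUF; apply: (@measure_semi_sigma_additive _ _ _ (lebesgue_rV R n)) => //.
  by move=> k; exact: (measurable_grid_set (mF k)).
by apply: bigcup_measurable => k _; exact: (measurable_grid_set (mF k)).
Qed.

HB.instance Definition _ := isMeasure.Build _ _ _ lebesgue_grid
  lebesgue_grid0 lebesgue_grid_ge0 lebesgue_grid_sigma.

Let I : measurableType _ := g_sigma_algebraType (@measurable _ grid_rV).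

Lemma sigma_grid_set (A : set 'rV[R]_n) : <<s @measurable _ grid_rV >> A -> measurable A.
Proof.
apply: smallest_sub; first exact: sigma_algebra_measurable.
exact: measurable_grid_set.
Qed.

Lemma open_sigma_grid_set (U : set 'rV[R]_n) : open U -> <<s @measurable _ grid_rV >> U.
Proof.
(* [F d] is the union of the cells of mesh 1/(d+1) contained in [U]; a point of [U] is caught as
   soon as the mesh is smaller than its sup-norm distance to the complement. *)
move=> oU; pose F d := @gfloor R n d @^-1` [set z | gfloor d @^-1` [set z] `<=` U].
have -> : U = \bigcup_d F d.
  apply/seteqP; split => [v Uv|v [d _ h]]; last exact: h.
  have /nbhs_ballP[e /= e0 ve] : nbhs v U by exact: open_nbhs_nbhs.
  have [d _ /(_ d (leqnn d))/= de] := near_infty_natSinv_lt (PosNum e0).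
  exists d => // w /= wv; apply: ve; split => // i j; rewrite (ord1 i) /ball/=.
  have d0 : 0 < d.+1%:R :> R by [].
  have := congr1 (fun z : 'rV_n => z 0 j) wv; rewrite !mxE => wvj.
  rewrite (le_lt_trans _ de)// -(ler_pM2r d0) mulVf ?gt_eqF// -[X in _ * X]gtr0_norm// -normrM mulrBl.
  have := floor_le_tmp (v 0 j * d.+1%:R); have := floor_le_tmp (w 0 j * d.+1%:R).
  have : w 0 j * d.+1%:R < (Num.floor (w 0 j * d.+1%:R) + 1)%:~R by rewrite -floor_lt_int ltrDl.
  have : v 0 j * d.+1%:R < (Num.floor (v 0 j * d.+1%:R) + 1)%:~R by rewrite -floor_lt_int ltrDl.
  rewrite wvj intrD => *; rewrite ler_norml; apply/andP; split; lra.
apply: (@sigma_algebra_bigcup _ _ (@measurable _ grid_rV)) => d.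
by apply: sub_sigma_algebra; exists d; eexists.
Qed.

Lemma measurable_sigma_grid (A : set 'rV[R]_n) : measurable A -> <<s @measurable _ grid_rV >> A.
Proof.
apply: smallest_sub; first exact: smallest_sigma_algebra.
have mf (i : 'I_n) : measurable_fun setT ((@rV_coord R n i) : I -> measurableTypeR R).
  apply: (measurability _ (RGenOpens.measurableE R)) => _ [_ [a [b ->]] <-]; rewrite setTI.
  apply: open_sigma_grid_set; apply: open_comp; last exact: itv_open.
  by move=> v _; exact: coord_continuous.
apply: (big_ind (fun X => X `<=` _)) => // [X Y|i _ _ [B mB <-]].
  by move=> hX hY; rewrite subUset.
exact: mf.
Qed.

(** Lebesgue measure seen on the sigma-algebra generated by the ring, where the uniqueness theorem
    compares it with the outer extension. *)
Definition lebesgue_sigma_grid (A : set I) : \bar R := lebesgue_rV R n (A : set 'rV[R]_n).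

Let lebesgue_sigma_grid0 : (lebesgue_sigma_grid set0 = 0)%E. Proof. exact: measure0. Qed.
Let lebesgue_sigma_grid_ge0 A : (0 <= lebesgue_sigma_grid A)%E. Proof. exact: measure_ge0. Qed.
Let lebesgue_sigma_grid_sigma : semi_sigma_additive lebesgue_sigma_grid.
Proof.
move=> F mF tF mUF; apply: (@measure_semi_sigma_additive _ _ _ (lebesgue_rV R n)) => //.
  by move=> k; exact: (sigma_grid_set (mF k)).
by apply: bigcup_measurable => k _; exact: (sigma_grid_set (mF k)).
Qed.

HB.instance Definition _ := isMeasure.Build _ _ _ lebesgue_sigma_grid
  lebesgue_sigma_grid0 lebesgue_sigma_grid_ge0 lebesgue_sigma_grid_sigma.

Lemma sigma_finite_lebesgue_grid : sigma_finite [set: grid_rV] lebesgue_grid.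
Proof.
exists (fun k : nat => @gfloor R n 0 @^-1` [set z : 'rV[int]_n | forall i, `|z 0 i| <= k%:Z]).
  apply/seteqP; split => // v _.
  exists (\max_i `|@gfloor R n 0 v 0%R i|%N)%N => // i.
  by rewrite -abszE lez_nat; exact: (@leq_bigmax _ (fun i : 'I_n => `|@gfloor R n 0 v 0%R i|%N) i).
move=> k; split; first by exists 0%N; eexists.
apply: (@lebesgue_rV_bounded _ _ (k%:R + 1)); first exact: measurable_gfloor.
move=> v h i; have := h i; rewrite mxE mulr1 ler_norml => /andP[h1 h2].
have := floor_le_tmp (v 0 i).
have : v 0 i < (Num.floor (v 0 i) + 1)%:~R by rewrite -floor_lt_int ltrDl.
move: h1 h2; rewrite -!(ler_int R) intrD mulrNz => *; rewrite ler_norml; apply/andP; split; lra.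
Qed.

(** [mu_ext] is an infimum over countable covers by grid sets, so this equality lets an inequality
    proved on grid sets pass to all measurable sets. *)
Lemma lebesgue_rV_ext (A : set 'rV[R]_n) : measurable A ->
  mu_ext lebesgue_grid A = lebesgue_rV R n A.
Proof.
move=> mA; apply: (measure_extension_unique sigma_finite_lebesgue_grid (mu' := lebesgue_sigma_grid)) => //.
exact: measurable_sigma_grid.
Qed.
End grid_ring.

(** * Comparison of Hausdorff and Lebesgue measure on R^m *)

Section hausdorff_lebesgue.
Context {R : realType} {m : nat}.
Hypothesis m0 : (0 < m)%N.
Local Notation L := (lebesgue_rV R m).
Local Notation H := (@hausdorff0 R m m).
Local Notation Q := (@unit_cube R m).

Let gfloorP d (v : 'rV[R]_m) (z : 'rV[int]_m) : gfloor d v = z <->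
  forall i, (z 0 i)%:~R <= v 0 i * d.+1%:R < (z 0 i + 1)%:~R.
Proof.
split=> [<- i|h]; last by apply/rowP => i; rewrite mxE; exact: floor_def.
by rewrite mxE floor_le_tmp -floor_lt_int ltrDl.
Qed.

Lemma lebesgue_gfloor1 d (z : 'rV[int]_m) :
  L (gfloor d @^-1` [set z]) = ((d.+1%:R^-1) ^+ m)%:E.
Proof.
have d0 : 0 < d.+1%:R :> R by [].
rewrite -(@lebesgue_rV_cube R m (\row_i ((z 0 i)%:~R / d.+1%:R)) _ true true) ?invr_gt0//.
have E i : (z 0 i)%:~R / d.+1%:R + d.+1%:R^-1 = (z 0 i + 1)%:~R / d.+1%:R :> R.
  by rewrite intrD mulrDl mul1r.
congr (L _); apply/seteqP; split => v /=.
  by move/gfloorP => h i; have := h i; rewrite mxE E in_itv/= ler_pdivrMr// ltr_pdivlMr.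
by move=> h; apply/gfloorP => i; have := h i; rewrite mxE E in_itv/= ler_pdivrMr// ltr_pdivlMr.
Qed.

Let unit_cubeE : Q = [set v | forall i, v 0 i \in `[0, 1]].
Proof. by apply/seteqP; split => v h i; have := h i; rewrite /= in_itv. Qed.

Lemma lebesgue_unit_cube : L Q = 1%E.
Proof.
rewrite unit_cubeE; have := @lebesgue_rV_cube R m 0 1 true false ltr01.
rewrite expr1n => <-; congr (L _); apply/seteqP; split => v h i; have := h i; by rewrite mxE add0r.
Qed.

(** A set of diameter D lies in the cube of side 2 D centred at any of its points, which gives the
    factor 2 ^ m. This crude constant suffices to show that the normalizing measure of the unit cube
    is not 0. *)
Lemma lebesgue_le_hausdorff0 (A : set 'rV[R]_m) : measurable A -> (L A <= (2 ^+ m)%:E * H A)%E.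
Proof.
move=> mA; apply: (@le_trans _ _ ((2 ^+ m)%:E * hausdorff_delta m 1 A)%E); last first.
  by rewrite lee_wpmul2l ?lee_fin ?exprn_ge0//; exact: hausdorff_delta_le_hausdorff0.
have t0 : 0 < (2 ^+ m : R) by rewrite exprn_gt0.
rewrite -lee_pdivrMl//; apply: le_ereal_inf_tmp => _ [C [C1 AC] <-]; rewrite lee_pdivrMl//.
rewrite -nneseriesZl; last by move=> k _; rewrite lee_fin exprn_ge0// diam_ge0.
have /all_sig[B hB] : forall k, {B : set 'rV[R]_m | [/\ C k `<=` B, measurable B &
    (L B <= (2 ^+ m)%:E * (diam (C k) ^+ m)%:E)%E]}.
  move=> k; apply: cid.
  have [->|/set0P[u Cu]] := eqVneq (C k) set0.
    by exists set0; split => //; rewrite measure0 mule_ge0// lee_fin exprn_ge0// diam_ge0.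
  pose b i := [set` `[u 0 i - diam (C k), u 0 i + diam (C k)]].
  have mb i : measurable (b i) by exact: measurable_itv.
  exists [set v | forall i, b i (v 0 i)]; split.
  - move=> v Cv i; rewrite /b/= in_itv/=.
    have : `|v 0 i - u 0 i| <= diam (C k).
      have := coord_le_enorm (v - u) i; rewrite !mxE => /le_trans; apply.
      exact: (enorm_le_diam (C1 k)).
    by rewrite ler_norml => /andP[? ?]; apply/andP; split; lra.
  - exact: measurable_prodset.
  - rewrite lebesgue_rV_prodset// -EFinM -exprMn.
    rewrite (_ : (_ ^+ m)%:E = \prod_(i < m) (2 * diam (C k))%:E)%E; last first.
      by rewrite prodEFin prodr_const card_ord.
    rewrite le_eqVlt; apply/orP; left; apply/eqP; apply: eq_bigr => i _.
    rewrite lebesgue_measure_itv/= lte_fin; have dC := diam_ge0 (C k).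
    case: ifPn => [_|]; first by rewrite -EFinB; congr EFin; ring.
    by rewrite -leNgt => ?; congr EFin; lra.
apply: (@le_trans _ _ (\sum_(k <oo) L (B k))%E); last first.
  by apply: lee_nneseries => k *; [exact: measure_ge0|case: (hB k)].
apply: (@le_trans _ _ (L (\bigcup_k B k))).
  apply: le_measure; rewrite ?inE//; first by apply: bigcup_measurable => k _; case: (hB k).
  by move=> v /AC [k _ Cv]; exists k => //; case: (hB k) => + _ _; exact.
apply: measure_sigma_subadditive => //; first by move=> k; case: (hB k).
by apply: bigcup_measurable => k _; case: (hB k).
Qed.

Lemma hausdorff0_unit_cube_gt0 : (0 < H Q)%E.
Proof.
rewrite lt_neqAle hausdorff0_ge0 andbT eq_sym; apply/eqP => h.
have mQ : measurable Q by rewrite unit_cubeE; exact: (measurable_box (fun=> BLeft _) (fun=> BRight _)).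
by have := lebesgue_le_hausdorff0 mQ; rewrite lebesgue_unit_cube h mule0 lee_fin ler10.
Qed.

Lemma hausdorff0_unit_cube_lty : (H Q < +oo)%E.
Proof.
(* A cell of side a has Euclidean diameter at most m a, whence m ^ m; the cells that cover the unit
   cube stay in [-2, 2]^m, of measure 4 ^ m. *)
apply: (@le_lt_trans _ _ ((m%:R ^+ m)%:E * (4 ^+ m)%:E)%E); last by rewrite -EFinM ltry.
apply: ge_ereal_sup => _ [d /= d0 <-].
have [k mk] : exists k : nat, m%:R / k.+1%:R <= d.
  have dm : 0 < d / m%:R by rewrite divr_gt0// ltr0n.
  have [k _ /(_ k (leqnn k))/= h] := near_infty_natSinv_lt (PosNum dm).
  by exists k; rewrite mulrC -ler_pdivlMr ?ltr0n// ltW.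
(* The index k+1 is included because the cube is closed: a coordinate equal to 1 has that floor. *)
pose Z := [set z : 'rV[int]_m | forall i, 0 <= z 0 i <= k.+1%:Z].
have k0 : 0 < k.+1%:R :> R by [].
apply: (@le_trans _ _ (hausdorff_delta m d (gfloor k @^-1` Z))).
  apply: le_hausdorff_delta => v Qv i; rewrite mxE; have /andP[v0 v1] := Qv i; apply/andP; split.
    by rewrite -ltzD1 -(ltr_int R) (le_lt_trans (mulr_ge0 v0 (ltW k0)))// -floor_lt_int ltrDl.
  by rewrite -(ler_int R) (le_trans (floor_le_tmp _))// ler_piMl// ltW.
apply: (@le_trans _ _ ((m%:R ^+ m)%:E * L (gfloor k @^-1` Z))%E).
  apply: le_lebesgue_gfloor; first by rewrite exprn_ge0.
  - exact: hausdorff_delta_sigma_subadditive.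
  - exact: hausdorff_delta_ge0.
  - apply/eqP; rewrite eq_le hausdorff_delta_ge0 andbT.
    apply: le_trans (hausdorff_delta_le_hausdorff0 _ _ d0) _.
    by rewrite hausdorff0_set0.
  - move=> z; rewrite lebesgue_gfloor1 -EFinM -exprMn.
    have sm (u v : 'rV[R]_m) : (gfloor k @^-1` [set z]) u -> (gfloor k @^-1` [set z]) v ->
        enorm (u - v) <= m%:R / k.+1%:R.
      move=> /= /gfloorP hu /= /gfloorP hv; apply: enorm_le_coord => // i; rewrite !mxE.
      rewrite -(ler_pM2r k0) mulVf ?gt_eqF// -[X in _ * X]gtr0_norm// -normrM mulrBl ler_norml.
      have := hu i; have := hv i; rewrite intrD => /andP[? ?] /andP[? ?].
      by apply/andP; split; lra.
    apply: le_trans (hausdorff_delta_small m0 _) _.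
      by move=> u v hu hv; rewrite (le_trans (sm _ _ hu hv)).
    rewrite lee_fin lerXn2r ?nnegrE ?diam_ge0 ?divr_ge0//.
    by apply: diam_le; rewrite ?divr_ge0.
apply: lee_wpmul2l; first by rewrite lee_fin exprn_ge0.
rewrite (_ : 4 = 2 * 2); last by ring.
have := @lebesgue_rV_symbox R m (fun=> 2) (fun=> ltr0Sn _ 1); rewrite prodr_const card_ord => <-.
apply: le_measure; rewrite ?inE//; first exact: measurable_gfloor.
  exact: (measurable_box (fun=> BLeft _) (fun=> BRight _)).
move=> v hv i; have := hv i; rewrite mxE -!(ler_int R) in_itv/= => /andP[v0 v1].
have k1 : 1 <= k.+1%:R :> R by rewrite ler1n.
have h1 := floor_le_tmp (v 0 i * k.+1%:R).
have h2 : v 0 i * k.+1%:R < (Num.floor (v 0 i * k.+1%:R) + 1)%:~R by rewrite -floor_lt_int ltrDl.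
have w0 : 0 <= v 0 i * k.+1%:R by exact: le_trans h1.
move: h2; rewrite intrD => h2.
have w1 : v 0 i * k.+1%:R <= 2 * k.+1%:R.
  by move: v1; rewrite -[k.+1%:~R]/(k.+1%:R) => v1; lra.
move: w0 w1; rewrite pmulr_lge0// ler_pM2r// => w0 ->; rewrite andbT; lra.
Qed.

Lemma hausdorff0_unit_cubeE : exists2 c : R, 0 < c & H Q = c%:E.
Proof.
have := hausdorff0_unit_cube_gt0; have := hausdorff0_unit_cube_lty.
by case: (H Q) => // c _; rewrite lte_fin; exists c.
Qed.

Lemma hausdorff0_cube (a : 'rV[R]_m) (s : R) : 0 < s ->
  (H [set v | forall i, (a 0 i <= v 0 i <= a 0 i + s)%R] <= (s ^+ m)%:E * H Q)%E.
Proof.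
move=> s0; apply: le_trans (hausdorff0_lipschitz (f := fun v => a + s *: v) m s0 _); last first.
  by move=> u v _ _; rewrite opprD addrACA subrr add0r -scalerBr enormZ gtr0_norm.
apply: le_hausdorff0 => v /= h; exists (s^-1 *: (v - a)).
  move=> i; have /andP[h1 h2] := h i; rewrite !mxE; apply/andP; split.
    by rewrite mulr_ge0 ?subr_ge0// invr_ge0 ltW.
  by rewrite ler_pdivrMl// mulr1 lerBlDl.
by rewrite scalerA mulfV ?gt_eqF// scale1r addrC subrK.
Qed.

Lemma hausdorff0_cube_ge (a : 'rV[R]_m) (s : R) : 0 < s ->
  ((s ^+ m)%:E * H Q <= H [set v | forall i, (a 0 i <= v 0 i <= a 0 i + s)%R])%E.
Proof.
move=> s0; have is0 : 0 < s^-1 by rewrite invr_gt0.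
set C := mkset _.
have := @hausdorff0_lipschitz R m m m (fun v => s^-1 *: (v - a)) s^-1 C is0.
rewrite exprVn -lee_pdivrMl ?invr_gt0 ?exprn_gt0// invrK => h.
apply: le_trans (h _); last first.
  by move=> u v _ _; rewrite -scalerBr opprB addrA subrK enormZ gtr0_norm.
apply: lee_wpmul2l; first by rewrite lee_fin exprn_ge0// ltW.
apply: le_hausdorff0 => v Qv; exists (a + s *: v).
  by move=> i; have /andP[? ?] := Qv i; rewrite !mxE lerDl lerD2l mulr_ge0 ?(ltW s0)//= ler_piMr// ltW.
by rewrite addrC addKr scalerA mulVf ?gt_eqF// scale1r.
Qed.

(** By outer approximation only grid cells matter, and a half-open cell is contained in a closed
    cube of the same side, whose Hausdorff measure is bounded by scaling the unit cube. *)
Lemma hausdorff0_le_lebesgue (A : set 'rV[R]_m) : measurable A -> (H A <= H Q * L A)%E.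
Proof.
move=> mA; have [c c0 HQ] := hausdorff0_unit_cubeE; rewrite HQ.
rewrite -lebesgue_rV_ext// -lee_pdivrMl//; apply: le_ereal_inf_tmp => _ [F [mF AF] <-].
rewrite lee_pdivrMl// -nneseriesZl; last by move=> k _; exact: measure_ge0.
apply: (le_trans (le_hausdorff0 _ AF)); apply: (le_trans (hausdorff0_sigma_subadditive _ _)).
apply: lee_nneseries => k *; first exact: hausdorff0_ge0.
have [d [Z ->]] := mF k; apply: le_lebesgue_gfloor; first exact: ltW.
- exact: hausdorff0_sigma_subadditive.
- exact: hausdorff0_ge0.
- exact: hausdorff0_set0.
- move=> z; rewrite lebesgue_gfloor1 -HQ muleC.
  apply: le_trans (hausdorff0_cube (\row_i ((z 0 i)%:~R / d.+1%:R)) _); last by rewrite invr_gt0.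
  apply: le_hausdorff0 => v /= /gfloorP h i; have /andP[h1 h2] := h i; rewrite mxE.
  have -> : (z 0 i)%:~R / d.+1%:R + d.+1%:R^-1 = (z 0 i + 1)%:~R / d.+1%:R :> R.
    by rewrite intrD mulrDl mul1r.
  by rewrite ler_pdivrMr// ler_pdivlMr// h1 ltW.
Qed.

(* Subadditivity and [H <= c L] on [A] and on its complement in a large cube force equality. *)
Lemma hausdorff0_lebesgue (A : set 'rV[R]_m) (M : R) : measurable A ->
  (forall v, A v -> forall i, `|v 0 i| <= M) -> H A = (H Q * L A)%E.
Proof.
move=> mA AM; apply/eqP; rewrite eq_le hausdorff0_le_lebesgue//=.
pose s := 2 * (`|M| + 1); have s0 : 0 < s by rewrite mulr_gt0// ltr_wpDl.
pose a : 'rV[R]_m := \row_i (- (`|M| + 1)).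
pose B := [set v : 'rV[R]_m | forall i, a 0 i <= v 0 i <= a 0 i + s].
have BE : B = [set v | forall i, v 0 i \in `[a 0 i, a 0 i + s]].
  by apply/seteqP; split => v h i; have := h i; rewrite in_itv.
have mB : measurable B by rewrite BE; exact: (measurable_box (fun=> BLeft _) (fun=> BRight _)).
have LB : L B = (s ^+ m)%:E by rewrite BE; exact: (@lebesgue_rV_cube R m a s true false s0).
have AB : A `<=` B.
  move=> v /AM h i; have := h i; rewrite mxE /s ler_norml => /andP[? ?].
  by have := ler_norm M => ?; apply/andP; split; lra.
have [c c0 HQ] := hausdorff0_unit_cubeE; rewrite HQ.
have mBA : measurable (B `\` A) by exact: measurableD.
have LAB : (L A + L (B `\` A) = L B)%E.
  rewrite -measureU//; last by rewrite setDE setICA setICr setI0.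
  by rewrite setDUK.
have HAB : (H B <= H A + H (B `\` A))%E.
  have := hausdorff0_sigma_subadditive m (bigcup2 A (B `\` A)).
  rewrite bigcup2E setDUK// => /le_trans; apply.
  rewrite (nneseries_split 0 2); last by move=> k _; exact: hausdorff0_ge0.
  rewrite big_mkord !big_ord_recl big_ord0 /= adde0 eseries0 ?adde0//.
  by move=> -[|[|k]]// _ _; exact: hausdorff0_set0.
have h1 := hausdorff0_cube_ge a s0; rewrite -/B HQ -LB -LAB in h1.
have h2 := hausdorff0_le_lebesgue mBA; rewrite HQ in h2.
(* The chain is c L B <= H B <= H A + H (B \ A) <= H A + c L (B \ A); the finite term c L (B \ A) is
   then cancelled. *)
have h3 : (c%:E * (L A + L (B `\` A)) <= H A + c%:E * L (B `\` A))%E.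
  by rewrite muleC (le_trans h1)// (le_trans HAB)// leeD2l.
have fBA : L (B `\` A) \is a fin_num.
  rewrite ge0_fin_numE//; apply: (@le_lt_trans _ _ (L B)); last by rewrite LB ltry.
  by apply: le_measure; rewrite ?inE// => v [].
move: h3; rewrite ge0_muleDr// leeD2rE// fin_numM//.
Qed.
End hausdorff_lebesgue.

Section set_function_integral.
Import HBNNSimple.

(** The integral makes sense for any set function, as a supremum over simple functions. Those lying
    below the positive or negative part of [f \_ D] have their nonzero levels inside [D], and the
    level 0 is multiplied by 0; so only the values on measurable subsets of [D] count. *)
Lemma eq_setfun_integral d (T : measurableType d) (R : realType) (mu1 mu2 : set T -> \bar R)
    (D : set T) (f : T -> \bar R) :
  (forall A, measurable A -> A `<=` D -> mu1 A = mu2 A) ->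
  (\int[mu1]_(x in D) f x = \int[mu2]_(x in D) f x)%E.
Proof.
move=> mu12.
have eq_sint (h : {nnsfun T >-> R}) (g : T -> \bar R) :
    (forall x, ~ D x -> g x = 0%E) -> (forall x, (h x)%:E <= g x)%E ->
    sintegral mu1 h = sintegral mu2 h.
  move=> gD hg; apply: eq_fsbigr => r _.
  have [->|r0] := eqVneq r 0; first by rewrite !mul0e.
  congr (_ * _)%E; apply: mu12 => // x /= hx; apply: contrapT => Dx.
  have := hg x; rewrite gD// lee_fin hx => r1; move/eqP: r0; apply.
  by apply/eqP; rewrite eq_le r1 -hx fun_ge0.
have eq_nnint (g : T -> \bar R) : (forall x, ~ D x -> g x = 0%E) ->
    ereal_sup [set sintegral mu1 h | h in [set h : {nnsfun T >-> R} | forall x, (h x)%:E <= g x]%E] =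
    ereal_sup [set sintegral mu2 h | h in [set h : {nnsfun T >-> R} | forall x, (h x)%:E <= g x]%E].
  move=> gD; congr ereal_sup; apply/seteqP; split => _ [h /= hg <-]; exists h => //.
    by rewrite (eq_sint _ g).
  by rewrite (eq_sint _ g).
have fD x : ~ D x -> (f \_ D) x = 0%E by move=> Dx; rewrite patchE memNset.
rewrite /integral; congr (_ - _)%E; apply: eq_nnint => x Dx.
  by rewrite funepos.unlock fD// maxxx.
by rewrite funeneg.unlock fD// oppe0 maxxx.
Qed.
End set_function_integral.

(** * Orthonormal frames and Hausdorff measure on a hyperplane *)

Section frame.
Context {R : realType} {m : nat}.
Variables (u : 'rV[R]_m.+1) (e : 'I_m -> 'rV[R]_m.+1).
Hypothesis u1 : inner u u = 1.
Hypothesis ue : forall i, inner u (e i) = 0.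
Hypothesis ee : forall i j, inner (e i) (e j) = (i == j)%:R.

Definition frame_mx : 'M[R]_(m, m.+1) := \matrix_i e i.
Definition frame (v : 'rV[R]_m) : 'rV[R]_m.+1 := v *m frame_mx.

Lemma innerE (v w : 'rV[R]_m.+1) : inner v w = (v *m w^T) 0 0.
Proof. by rewrite mxE; apply: eq_bigr => i _; rewrite mxE. Qed.

Lemma frame_sum v : frame v = \sum_i v 0 i *: e i.
Proof. by rewrite /frame mulmx_sum_row; apply: eq_bigr => i _; rewrite rowK. Qed.

Lemma frame_mxK : frame_mx *m frame_mx^T = 1%:M.
Proof.
apply/matrixP => i j; rewrite !mxE -ee.
by apply: eq_bigr => k _; rewrite !mxE.
Qed.

Lemma frameK v : frame v *m frame_mx^T = v.
Proof. by rewrite /frame -mulmxA frame_mxK mulmx1. Qed.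

Lemma inner_frame v i : inner (frame v) (e i) = v 0 i.
Proof.
rewrite -[in RHS](frameK v) innerE !mxE; apply: eq_bigr => j _.
by rewrite !mxE.
Qed.

Lemma inner_frameu v : inner (frame v) u = 0.
Proof.
rewrite frame_sum /inner; under eq_bigr do rewrite summxE mulr_suml.
rewrite exchange_big big1// => i _; transitivity (v 0 i * inner u (e i)); last by rewrite ue mulr0.
rewrite mulr_sumr.
by apply: eq_bigr => j _; rewrite !mxE; ring.
Qed.

Definition full_frame : 'M[R]_(1 + m) := col_mx u frame_mx.

Lemma full_frameE t v : rV_cons (t, v) *m full_frame = t *: u + frame v.
Proof. by rewrite -mul_scalar_mx; exact: (mul_row_col t%:M v u frame_mx). Qed.

Lemma frame_orth : u *m frame_mx^T = 0.
Proof.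
apply/rowP => i; rewrite !mxE; transitivity (inner u (e i)); last exact: ue.
by apply: eq_bigr => j _; rewrite !mxE.
Qed.

Lemma full_frameK : full_frame *m full_frame^T = 1%:M.
Proof.
rewrite /full_frame tr_col_mx mul_col_row frame_mxK frame_orth scalar_mx_block.
have -> : frame_mx *m u^T = 0 by rewrite -[LHS]trmxK trmx_mul trmxK frame_orth trmx0.
congr block_mx; apply/matrixP => i j; rewrite !ord1 [RHS]mxE eqxx -u1 innerE//.
Qed.

(** The family formed by [u] and the [e i] is complete by a dimension count: for the square matrix
    [full_frame], a right inverse is also a left inverse. *)
Lemma frame_hyperplane w : inner w u = 0 -> frame (w *m frame_mx^T) = w.
Proof.
move=> wu; rewrite -[RHS]mulmx1 -(mulmx1C full_frameK) mulmxA.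
rewrite {1}/full_frame tr_col_mx mul_mx_row mul_row_col.
have -> : w *m u^T = 0 by apply/matrixP => i j; rewrite !ord1 [RHS]mxE -wu innerE.
by rewrite mul0mx add0r.
Qed.

Lemma enorm_frame v : enorm (frame v) = enorm v.
Proof.
rewrite /enorm innerE /frame trmx_mul mulmxA -(mulmxA v) frame_mxK mulmx1; congr Num.sqrt.
by rewrite mxE; apply: eq_bigr => i _; rewrite mxE.
Qed.

Lemma frameB v w : frame (v - w) = frame v - frame w.
Proof. by rewrite /frame mulmxBl. Qed.

Lemma measurable_frame : measurable_fun setT frame.
Proof. exact: measurable_fun_linear_rV. Qed.

(** [frame] is an isometry, and so is its transpose on the hyperplane. Two Lipschitz bounds with
    constant 1 identify the unnormalized measures, and the normalization turns the one on R^m into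
    Lebesgue measure. *)
Lemma hausdorff_hyperplane (A : set 'rV[R]_m.+1) (M : R) : (0 < m)%N -> measurable A ->
  A `<=` hyperplane u -> (forall v, A v -> enorm v <= M) ->
  hausdorff m A = lebesgue_rV R m (frame @^-1` A).
Proof.
move=> m0 mA Au AM; have [c c0 HQ] := @hausdorff0_unit_cubeE R m m0.
have mA1 : measurable (frame @^-1` A).
  by rewrite -[X in measurable X]setTI; exact: measurable_frame.
have -> : hausdorff m A = (c^-1%:E * hausdorff0 m A)%E by rewrite /hausdorff HQ.
have -> : hausdorff0 m A = hausdorff0 m (frame @^-1` A); last first.
  rewrite (hausdorff0_lebesgue m0 (M := M))//; first by rewrite HQ muleA -EFinM mulVf ?gt_eqF// mul1e.
  by move=> v Av i; rewrite (le_trans (coord_le_enorm _ _))// -enorm_frame AM.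
have E1 : A = frame @` (frame @^-1` A).
  apply/seteqP; split => [w Aw|_ [v Av <-]//].
  by exists (w *m frame_mx^T); rewrite /= ?frame_hyperplane//; exact: Au.
have E2 : frame @^-1` A = (fun w => w *m frame_mx^T) @` A.
  apply/seteqP; split => [v Av|_ [w Aw <-]]; first by exists (frame v) => //; rewrite frameK.
  by rewrite /= frame_hyperplane//; exact: Au.
apply/eqP; rewrite eq_le; apply/andP; split.
  rewrite {1}E1; apply: le_trans (hausdorff0_lipschitz m (ltr01) _) _.
    by move=> v w _ _; rewrite -frameB enorm_frame mul1r.
  by rewrite expr1n mul1e.
rewrite {1}E2; apply: le_trans (hausdorff0_lipschitz m (ltr01) _) _.
  move=> v w Av Aw; rewrite mul1r -mulmxBl -enorm_frame frame_hyperplane//.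
  have -> : inner (v - w) u = inner v u - inner w u by rewrite !innerE mulmxBl !mxE.
  by rewrite (Au _ Av) (Au _ Aw) subrr.
by rewrite expr1n mul1e.
Qed.

(** The right-hand side is an integral against the push-forward of Lebesgue measure by [frame],
    which agrees with [hausdorff] on the measurable subsets of [D]. *)
Lemma integral_hausdorff_hyperplane (D : set 'rV[R]_m.+1) (M : R) (f : 'rV[R]_m.+1 -> \bar R) :
  (0 < m)%N -> measurable D -> D `<=` hyperplane u -> (forall v, D v -> enorm v <= M) ->
  measurable_fun D f -> (forall v, D v -> 0 <= f v)%E ->
  (\int[hausdorff m]_(v in D) f v = \int[lebesgue_rV R m]_(v in frame @^-1` D) f (frame v))%E.
Proof.
move=> m0 mD Du DM mf f0.
rewrite -[RHS]/(\int[lebesgue_rV R m]_(v in frame @^-1` D) (f \o frame) v)%E.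
rewrite -(ge0_integral_pushforward measurable_frame)//; last by move=> v /set_mem; exact: f0.
apply: eq_setfun_integral => A mA AD.
rewrite (hausdorff_hyperplane (M := M))//; first exact: subset_trans Du.
by move=> v /AD; exact: DM.
Qed.
End frame.

(** * Normal and curvature of a level set *)

Section differential_eps.
Context {R : realType}.

Lemma nbhs0_epsP (V : normedModType R) (P : V -> Prop) :
  (\forall h \near (0 : V), P h) <-> exists2 r : R, 0 < r & forall h, `|h| < r -> P h.
Proof.
split=> [/nbhs_ballP[r /= r0 h]|[r r0 h]].
  by exists r => // v vr; apply: h; rewrite -ball_normE /= sub0r normrN.
by apply/nbhs_ballP; exists r => //= v; rewrite -ball_normE /= sub0r normrN => /h.
Qed.

Lemma diff_eps (V W : normedModType R) (f : V -> W) x (eps : R) : differentiable f x -> 0 < eps ->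
  exists2 r : R, 0 < r & forall h, `|h| < r -> `|f (x + h) - f x - 'd f x h| <= eps * `|h|.
Proof.
move=> /diff_locally /eqaddoP/(_ eps) h e0.
have /nbhs0_epsP[r r0 hr] := h e0.
by exists r => // v /hr; rewrite (addrC x v) -addrA -opprD; exact.
Qed.

Lemma is_derive_epsP (V : normedModType R) (c : R -> V) v : is_derive (0 : R) 1 c v <->
  forall eps : R, 0 < eps -> exists2 r : R, 0 < r &
    forall t, `|t| < r -> `|c t - c 0 - t *: v| <= eps * `|t|.
Proof.
split=> [cv eps e0|h].
  have dc : differentiable c 0 by apply/derivable1_diffP.
  have [r r0 hr] := diff_eps dc e0; exists r => // t /hr; rewrite add0r.
  have -> // : 'd c 0 t = t *: v.
  by rewrite -[t in LHS]mulr1 linearZ/= -deriveE// derive_val.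
have l : (fun t : R => t^-1 *: (c (t *: 1 + 0) - c 0)) @ 0^' --> v.
  apply/cvgrPdist_le => e e0; have [r r0 hr] := h e e0.
  near=> t.
  have t0 : t != 0 by near: t; exact: nbhs_dnbhs_neq.
  have tr : `|t| < r by near: t; apply: dnbhs0_lt.
  have := hr _ tr; rewrite addr0 [_ *: 1]mulr1 => ht.
  rewrite distrC -(ler_pM2r (_ : 0 < `|t|)) ?normr_gt0// mulrC -normrZ.
  by rewrite scalerBr scalerA mulfV// scale1r.
by apply: DeriveDef; [apply/cvg_ex; exists v|exact/cvg_lim].
Unshelve. all: by end_near. Qed.

Lemma is_derive_comp_diff (V : normedModType R) (c : R -> V) (f : V -> R) (s : R) v :
  is_derive s 1 c v -> differentiable f (c s) -> is_derive s 1 (f \o c) ('D_v f (c s)).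
Proof.
move=> cv df; have dc : differentiable c s by apply/derivable1_diffP.
have dfc : differentiable (f \o c) s by exact: differentiable_comp.
apply: DeriveDef; first exact: diff_derivable.
have <- : 'D_1 c s = v by rewrite derive_val.
by rewrite !deriveE// diff_comp.
Qed.

Lemma near_pos_of_derive (V : normedModType R) (f : V -> R) x v :
  differentiable f x -> f x = 0 -> 0 < 'D_v f x ->
  \forall t \near (0 : R), (0 < t -> 0 < f (x + t *: v)) /\ (t < 0 -> f (x + t *: v) < 0).
Proof.
move=> df fx Df.
have dl : is_derive (0 : R) 1 (fun t => x + t *: v) v.
  apply/is_derive_epsP => e e0; exists 1 => // t _.
  by rewrite scale0r addr0 (addrC x) addrK subrr normr0 mulr_ge0// ltW.
have := @is_derive_comp_diff _ _ f 0 _ dl; rewrite scale0r addr0 => /(_ df)/is_derive_epsP.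
have D2 : 0 < 'D_v f x / 2 by rewrite divr_gt0.
move=> /(_ _ D2)[r r0 hr].
apply/nbhs0_epsP; exists r => // t /hr /=; rewrite scale0r addr0 fx subr0 -[t *: 'D_v f x]/(t * 'D_v f x).
move: ('D_v f x) Df D2 (f _) => D D0 D2 y; rewrite ler_norml => /andP[h1 h2]; split => t0.
  by move: h1 h2; rewrite gtr0_norm// => h1 h2; have := mulr_gt0 D0 t0; lra.
have nt0 : 0 < - t by rewrite oppr_gt0.
by move: h1 h2; rewrite ltr0_norm// => h1 h2; have := mulr_gt0 D0 nt0; lra.
Qed.

(** For |s| <= eps |t| the value of [f] at y + t v + s w is s D up to an error eps |t| D, so it is
    nonpositive at s = - eps |t| and nonnegative at s = eps |t|; the intermediate value theorem
    gives a zero. *)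
Lemma level_set_step (V : normedModType R) (f : V -> R) (U : set V) y v w (eps : R) :
  open U -> U y -> (forall z, U z -> differentiable f z) -> f y = 0 ->
  'D_v f y = 0 -> 0 < 'D_w f y -> 0 < eps ->
  exists2 r : R, 0 < r & forall t, `|t| < r -> exists s, `|s| <= eps * `|t| /\ f (y + t *: v + s *: w) = 0.
Proof.
move=> oU Uy df fy Dv Dw e0; set D := 'D_w f y in Dw.
pose C := `|v| + eps * `|w| + 1.
have C0 : 0 < C by rewrite ltr_wpDl// addr_ge0// mulr_ge0// ltW.
(* Displacements have norm at most C |t|, so differentiability with precision eps D / C yields
   exactly the error eps |t| D. *)
have eta0 : 0 < eps * D / C by rewrite divr_gt0// mulr_gt0.
have [r1 r10 h1] := diff_eps (df _ Uy) eta0.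
have /nbhs_ballP[r2 /= r20 h2] : nbhs y U by exact: open_nbhs_nbhs.
exists (Num.min r1 r2 / C); first by rewrite divr_gt0// lt_min r10.
move=> t; rewrite ltr_pdivlMr// mulrC lt_min => /andP[t1 t2].
have hs s : `|s| <= eps * `|t| -> `|t *: v + s *: w| <= C * `|t|.
  move=> st; rewrite (le_trans (ler_normD _ _))// !normrZ.
  have : `|s| * `|w| <= eps * `|t| * `|w| by rewrite ler_wpM2r.
  have : 0 <= `|t| by [].
  by rewrite /C; lra.
have Us s : `|s| <= eps * `|t| -> U (y + t *: v + s *: w).
  move=> /hs st; apply: h2; rewrite -ball_normE /= -addrA opprD addrA subrr sub0r normrN.
  exact: le_lt_trans t2.
have et0 : 0 <= eps * `|t| by rewrite mulr_ge0// ltW.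
have fs s : `|s| <= eps * `|t| -> `|f (y + t *: v + s *: w) - s * D| <= eps * `|t| * D.
  move=> st; have h := h1 (t *: v + s *: w).
  rewrite addrA fy subr0 linearD !linearZ/= -!deriveE in h; try exact: df.
  rewrite Dv scaler0 add0r -[_ *: 'D_w f y]/(s * D) in h; apply: (le_trans (h _)).
    exact: le_lt_trans (hs _ st) t1.
  rewrite (le_trans (ler_wpM2l (ltW eta0) (hs _ st)))//.
  by rewrite mulrA divfK ?gt_eqF// mulrAC.
have nle : - (eps * `|t|) <= eps * `|t| by lra.
have [s s1 s2] : exists2 s, s \in `[- (eps * `|t|), eps * `|t|] & f (y + t *: v + s *: w) = 0.
  apply: IVT => //.
    apply: continuous_in_subspaceT => s /set_mem/=; rewrite in_itv/= -ler_norml => st.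
    have cg : continuous_at s (fun s : R => y + t *: v + s *: w).
      by apply: cvgD; [exact: cvg_cst|apply: cvgZl; exact: cvg_id].
    exact: (continuous_comp cg (differentiable_continuous (df _ (Us _ st)))).
  have := fs (- (eps * `|t|)); rewrite normrN ger0_norm// => /(_ (lexx _)).
  have := fs (eps * `|t|); rewrite ger0_norm// => /(_ (lexx _)).
  rewrite !ler_norml => /andP[a1 a2] /andP[b1 b2].
  by rewrite ge_min le_max; apply/andP; split; apply/orP; [left|right]; lra.
by exists s; split => //; move: s1; rewrite in_itv/= -ler_norml.
Qed.

(* [level_set_step] puts zeros of [f] at distance [o(t)] from [y + t v]; the curve picks an
   almost closest one, so that no continuity in [t] (implicit function theorem) is needed. *)
Lemma level_set_curve (V : normedModType R) (f : V -> R) (U : set V) y v w :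
  open U -> U y -> (forall z, U z -> differentiable f z) -> f y = 0 ->
  'D_v f y = 0 -> 0 < 'D_w f y ->
  exists c : R -> V, [/\ c 0 = y, \forall t \near 0, f (c t) = 0 & is_derive (0 : R) 1 c v].
Proof.
move=> oU Uy df fy Dv Dw; have step eps := @level_set_step V f U y v w eps oU Uy df fy Dv Dw.
(* The infimum of |s| over the zeros need not be attained; the slack t ^ 2 is o(t), and it vanishes
   at t = 0, which forces the curve to start at [y]. *)
pose P t s := f (y + t *: v + s *: w) = 0 /\
  forall s', f (y + t *: v + s' *: w) = 0 -> `|s| <= `|s'| + t ^+ 2.
have Pex t s0 : f (y + t *: v + s0 *: w) = 0 -> exists s, P t s.
  move=> fs0; have [->|t0] := eqVneq t 0.
    exists 0; split; first by rewrite !scale0r !addr0.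
    by move=> s' _; rewrite normr0 expr0n addr0.
  pose S := [set `|s| | s in [set s | f (y + t *: v + s *: w) = 0]].
  have iS : has_inf S.
    split; first by exists `|s0|, s0.
    by exists 0 => _ [s _ <-].
  have t20 : 0 < t ^+ 2 by rewrite lt_neqAle sqr_ge0 andbT eq_sym sqrf_eq0.
  have [_ [s fs <-] hs] := inf_adherent t20 iS.
  exists s; split => // s' fs'; rewrite (le_trans (ltW hs))// lerD2r.
  by apply: ge_inf; [case: iS|exists s'].
pose s t := xget 0 (P t).
have sP t s0 : f (y + t *: v + s0 *: w) = 0 -> P t (s t).
  by move=> /Pex[s1 Ps1]; exact: (xgetPex 0 (ex_intro _ s1 Ps1)).
have s0 : s 0 = 0.
  have [|_ /(_ 0)] := sP 0 0; rewrite !scale0r !addr0// => /(_ fy).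
  by rewrite normr0 expr0n add0r normr_le0 => /eqP.
have sle eps : 0 < eps -> exists2 r : R, 0 < r & forall t, `|t| < r ->
    f (y + t *: v + s t *: w) = 0 /\ `|s t| <= eps * `|t|.
  move=> e0; have e20 : 0 < eps / 2 by rewrite divr_gt0.
  (* For |t| < eps / 2 the slack t ^ 2 is at most (eps / 2) |t|, the other half of the allowance
     being used by [step]. *)
  have [r r0 hr] := step _ e20; exists (Num.min r (eps / 2)); first by rewrite lt_min r0.
  move=> t; rewrite lt_min => /andP[tr te]; have [s1 [s1t fs1]] := hr _ tr.
  have [f0 /(_ _ fs1) h] := sP _ _ fs1; split => //; rewrite (le_trans h)//.
  rewrite -real_normK ?num_real// expr2.
  have : `|t| * `|t| <= eps / 2 * `|t| by rewrite ler_wpM2r// ltW.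
  lra.
exists (fun t => y + t *: v + s t *: w); split; first by rewrite s0 !scale0r !addr0.
  by apply/nbhs0_epsP; have [r r0 hr] := sle 1 ltr01; exists r => // t /hr[].
apply/is_derive_epsP => e e0.
have ew0 : 0 < e / (`|w| + 1) by rewrite divr_gt0// ltr_wpDl.
have [r r0 hr] := sle _ ew0; exists r => // t /hr[_ st].
rewrite s0 !scale0r !addr0 (addrAC _ (s t *: w)) (addrAC y) subrr add0r addrAC subrr add0r normrZ.
rewrite (le_trans (ler_wpM2r (normr_ge0 w) st))// mulrAC ler_wpM2r//.
by rewrite -mulrA ler_piMr ?(ltW e0)// ler_pdivrMl ?ltr_wpDl// mulr1 lerDl.
Qed.

End differential_eps.

Lemma innerDl (R : realType) n (u v w : 'rV[R]_n) : inner (u + v) w = inner u w + inner v w.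
Proof. by rewrite /inner -big_split; apply: eq_bigr => i _; rewrite mxE mulrDl. Qed.

Lemma innerC (R : realType) n (u v : 'rV[R]_n) : inner u v = inner v u.
Proof. by apply: eq_bigr => i _; rewrite mulrC. Qed.

Lemma innerZl (R : realType) n (s : R) (u v : 'rV[R]_n) : inner (s *: u) v = s * inner u v.
Proof. by rewrite /inner mulr_sumr; apply: eq_bigr => i _; rewrite mxE mulrA. Qed.

Lemma innerDr (R : realType) n (u v w : 'rV[R]_n) : inner u (v + w) = inner u v + inner u w.
Proof. by rewrite !(innerC u) innerDl. Qed.

Lemma innerZr (R : realType) n (s : R) (u v : 'rV[R]_n) : inner u (s *: v) = s * inner u v.
Proof. by rewrite !(innerC u) innerZl. Qed.

Lemma innerNl (R : realType) n (u v : 'rV[R]_n) : inner (- u) v = - inner u v.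
Proof. by rewrite -scaleN1r innerZl mulN1r. Qed.

Lemma inner_eq0 (R : realType) n (u : 'rV[R]_n) : inner u u = 0 -> u = 0.
Proof.
move=> h; apply/rowP => i; rewrite mxE; apply/eqP.
have := coord_le_enorm u i; rewrite /enorm h sqrtr0 => h1.
by rewrite -normr_le0.
Qed.

Lemma enorm_sqr (R : realType) n (u : 'rV[R]_n) : enorm u ^+ 2 = inner u u.
Proof. by rewrite sqr_sqrtr// inner_ge0. Qed.

Lemma cvg_line (R : realType) (V : normedModType R) (y v : V) :
  (fun t : R => y + t *: v) @ (0 : R) --> y.
Proof.
have h : continuous_at (0 : R) (fun t : R => y + t *: v).
  by apply: cvgD; [exact: cvg_cst|apply: cvgZl; exact: cvg_id].
by move: h; rewrite /continuous_at scale0r addr0.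
Qed.

Definition grad (R : realType) n (phi : 'rV[R]_n -> R) y : 'rV[R]_n :=
  \row_i 'D_(delta_mx 0 i) phi y.

Lemma derive_grad (R : realType) n (phi : 'rV[R]_n -> R) y v : differentiable phi y ->
  'D_v phi y = inner (grad phi y) v.
Proof.
move=> dphi; rewrite deriveE// {1}(row_sum_delta v) linear_sum.
by apply: eq_bigr => i _; rewrite linearZ/= mxE deriveE// mulrC.
Qed.

Lemma near0_rightP (R : realType) (P : R -> Prop) :
  (\forall t \near 0^'+, P t) <-> exists2 r : R, 0 < r & forall t, 0 < t -> t < r -> P t.
Proof.
split=> [h|[r r0 h]].
  have /nbhs0_epsP[r r0 hr] : \forall t \near (0 : R), 0 < t -> P t by exact: h.
  by exists r => // t t0 tr; apply: hr => //; rewrite gtr0_norm.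
suff : \forall t \near (0 : R), 0 < t -> P t by [].
apply/nbhs0_epsP; exists r => // t tr t0; apply: h => //.
by rewrite gtr0_norm in tr.
Qed.

(** * Boundary, tangent vectors and normal of a superlevel set *)

Section level_set.
Context {R : realType} {n : nat}.
Variables (G U : set 'rV[R]_n) (phi : 'rV[R]_n -> R).
Hypothesis cG : closed G.
Hypothesis oU : open U.
Hypothesis dphi : forall y, U y -> differentiable phi y.
Hypothesis regphi : forall y, U y -> exists v, 'D_v phi y != 0.
Hypothesis GU : G `&` U = [set y | 0 <= phi y] `&` U.

Lemma level_setE y : U y -> G y <-> 0 <= phi y.
Proof.
move=> Uy; have : (G `&` U) y <-> ([set y | 0 <= phi y] `&` U) y by rewrite GU.
by move=> [h1 h2]; split => h; [have [] := h1 (conj h Uy)|have [] := h2 (conj h Uy)].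
Qed.

Lemma grad_gt0 y : U y -> 0 < inner (grad phi y) (grad phi y).
Proof.
move=> Uy; rewrite lt_neqAle inner_ge0 andbT eq_sym; apply/eqP => /inner_eq0 n0.
have [v] := regphi Uy; rewrite derive_grad; last exact: dphi.
by rewrite n0 /inner big1 ?eqxx// => i _; rewrite mxE mul0r.
Qed.

Lemma enorm_grad_gt0 y : U y -> 0 < enorm (grad phi y).
Proof. by move=> Uy; rewrite sqrtr_gt0; exact: grad_gt0. Qed.

Lemma near_line y v : U y -> \forall t \near (0 : R), U (y + t *: v).
Proof.
by move=> Uy; exact: (cvg_line v (open_nbhs_nbhs (conj oU Uy))).
Qed.

(** By continuity, a point of [G] where [phi] is positive is interior. At a zero of [phi], a small
    move against the gradient makes [phi] negative and leaves [G], so the point is not interior. *)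
Lemma boundary_level y : U y -> boundary G y <-> phi y = 0.
Proof.
move=> Uy; split=> [[Gy nGy]|y0].
  have {Gy} : 0 <= phi y by apply/level_setE => //; move: Gy; rewrite -(closure_id G).1.
  rewrite le_eqVlt => /orP[/eqP//|y0]; exfalso; apply: nGy.
  have cphi : {for y, continuous phi} by apply: differentiable_continuous; exact: dphi.
  have : \forall z \near y, 0 < phi z.
    exact: (@cvgr_gt _ _ (nbhs y) _ phi (phi y) cphi 0 y0).
  rewrite /interior; apply: filterS2 (open_nbhs_nbhs (conj oU Uy)) => z Uz z0.
  by apply/level_setE => //; exact: ltW.
split; first by apply: subset_closure; apply/(level_setE Uy); rewrite y0.
move=> Gy.
have : \forall t \near (0 : R), G (y + t *: (grad phi y)).
  exact: (cvg_line (grad phi y) Gy).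
have := near_line (grad phi y) Uy.
have : 0 < 'D_(grad phi y) phi y by rewrite derive_grad; [exact: grad_gt0|exact: dphi].
move=> /(near_pos_of_derive (dphi Uy) y0) h1 h2 h3.
have : \forall t \near (0 : R), t < 0 -> False.
  near=> t => t0.
  have [_ /(_ t0)] : (0 < t -> 0 < phi (y + t *: grad phi y)) /\ (t < 0 -> phi (y + t *: grad phi y) < 0).
    by near: t.
  have : 0 <= phi (y + t *: grad phi y) by apply/level_setE; near: t.
  by case: ltgtP.
move=> /nbhs0_epsP[r r0 /(_ (- (r / 2)))]; rewrite normrN gtr0_norm ?divr_gt0//.
by rewrite ltr_pdivrMr// mulr_natr mulr2n ltrDl => /(_ r0); apply; rewrite oppr_lt0 divr_gt0.
Unshelve. all: by end_near. Qed.

(** Along a curve in the boundary [phi] is constantly 0, which gives one direction; the other one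
    uses [level_set_curve] with the gradient as transversal direction. *)
Lemma tangent_level y v : U y -> phi y = 0 ->
  tangent_vector (boundary G) y v <-> 'D_v phi y = 0.
Proof.
move=> Uy y0; split=> [[c [c0 bc dc]]|Dv].
  have cc : {for 0, continuous c} by apply: differentiable_continuous; apply/derivable1_diffP.
  have Uc : \forall t \near (0 : R), U (c t).
    by apply: cc; rewrite c0; exact: open_nbhs_nbhs.
  have : is_derive (0 : R) 1 (phi \o c) ('D_v phi (c 0)).
    by apply: is_derive_comp_diff => //; rewrite c0; exact: dphi.
  rewrite c0 => h; have <- := @derive_val _ _ _ _ _ _ _ h.
  rewrite -[RHS](derive_cst (0 : R) (0 : R) 1).
  apply: near_eq_derive.
  near=> t; rewrite /=; apply/boundary_level; first by near: t.
  by near: t.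
have Dn : 0 < 'D_(grad phi y) phi y by rewrite derive_grad; [exact: grad_gt0|exact: dphi].
have [c [c0 fc dc]] := level_set_curve oU Uy dphi y0 Dv Dn.
exists c; split => //.
have cc : {for 0, continuous c} by apply: differentiable_continuous; apply/derivable1_diffP.
have Uc : \forall t \near (0 : R), U (c t).
  by apply: cc; rewrite c0; exact: open_nbhs_nbhs.
near=> t; apply/boundary_level; first by near: t.
by near: t.
Unshelve. all: by end_near. Qed.

Lemma inward_normal_level y : U y -> phi y = 0 ->
  is_inward_unit_normal G y ((enorm (grad phi y))^-1 *: grad phi y).
Proof.
move=> Uy y0; have en := enorm_grad_gt0 Uy; split.
- by rewrite innerZl innerZr -enorm_sqr expr2 mulKf ?gt_eqF// mulVf// gt_eqF.
- move=> v /tangent_level-/(_ Uy y0); rewrite derive_grad; last exact: dphi.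
  by move=> h; rewrite innerZl h mulr0.
set u := _ *: _.
have Du : 0 < 'D_u phi y.
  rewrite derive_grad; last exact: dphi.
  by rewrite innerZr mulr_gt0 ?invr_gt0// grad_gt0.
have h1 := near_pos_of_derive (dphi Uy) y0 Du; have h2 := near_line u Uy.
near=> t; apply/level_setE; first by near: t; apply: cvg_within.
apply: ltW; have : 0 < t by near: t; exact: nbhs_right_gt.
near: t; apply: cvg_within; apply: filterS h1 => t [h _]; exact: h.
Unshelve. all: by end_near. Qed.

(** As [nu] is a [get], uniqueness has to be shown. The component of a candidate orthogonal to the
    gradient is tangent, hence orthogonal to the candidate too, hence 0. Unit length leaves two
    signs, and the inward condition rules out the negative one. *)
Lemma nu_level y : U y -> phi y = 0 -> nu G y = (enorm (grad phi y))^-1 *: grad phi y.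
Proof.
move=> Uy y0; have en := enorm_grad_gt0 Uy.
apply: get_unique; first exact: inward_normal_level.
move=> u [u1 ut uG].
have [k kE] : exists k, k = inner u (grad phi y) / inner (grad phi y) (grad phi y) by eexists.
have nn := grad_gt0 Uy.
have ukn : inner (grad phi y) (u - k *: grad phi y) = 0.
  by rewrite innerDr -scaleNr innerZr kE innerC mulNr divfK ?gt_eqF// subrr.
have /ut : tangent_vector (boundary G) y (u - k *: grad phi y).
  apply/tangent_level => //; rewrite derive_grad//; exact: dphi.
move=> h.
have uk : u = k *: grad phi y.
  apply/eqP; rewrite -subr_eq0; apply/eqP; apply: inner_eq0.
  by rewrite innerDl h innerNl innerZl ukn mulr0 oppr0 addr0.
suff -> : (enorm (grad phi y))^-1 = k by [].
have k2 : (k * enorm (grad phi y)) ^+ 2 = 1.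
  by rewrite exprMn enorm_sqr -u1 uk innerZl innerZr; ring.
have : k * enorm (grad phi y) = 1 \/ k * enorm (grad phi y) = -1.
  by move/eqP : k2; rewrite sqrf_eq1 => /orP[/eqP|/eqP]; [left|right].
case=> [k1|k1]; first by rewrite -[LHS]mul1r -k1 mulfK// gt_eqF.
exfalso.
have k0 : k < 0 by rewrite -(pmulr_llt0 _ en) k1 oppr_lt0.
have Du : 0 < 'D_(- u) phi y.
  rewrite derive_grad; last exact: dphi.
  by rewrite uk -scaleNr innerZr mulr_gt0// oppr_gt0.
have /nbhs0_epsP[r1 r10 h1] := near_pos_of_derive (dphi Uy) y0 Du.
have /nbhs0_epsP[r2 r20 h2] := near_line u Uy.
have /near0_rightP[r3 r30 h3] := uG.
pose t := Num.min r1 (Num.min r2 r3) / 2.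
have t0 : 0 < t by rewrite divr_gt0// !lt_min r10 r20.
have tlt : t < Num.min r1 (Num.min r2 r3) by rewrite ltr_pdivrMr// mulr_natr mulr2n ltrDl !lt_min r10 r20.
move: tlt; rewrite !lt_min => /and3P[t1 t2 t3].
have Gt := h3 _ t0 t3.
have Ut : U (y + t *: u) by apply: h2; rewrite gtr0_norm.
have pt := (level_setE Ut).1 Gt.
have := (h1 (- t) _).2; rewrite normrN gtr0_norm// oppr_lt0 => /(_ t1 t0).
by rewrite scalerN scaleNr opprK ltNge pt.
Qed.
End level_set.

Lemma coord_le_norm (R : realType) n (v : 'rV[R]_n) i : `|v 0 i| <= `|v|.
Proof.
rewrite [X in _ <= X]mx_normrE.
exact: (le_bigmax 0 (fun ij : 'I_1 * 'I_n => `|v ij.1 ij.2|) (0, i)).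
Qed.

Lemma abs_inner_le (R : realType) n (u v : 'rV[R]_n) : `|inner u v| <= `|u| * \sum_i `|v 0 i|.
Proof.
rewrite (le_trans (ler_norm_sum _ _ _))// mulr_sumr ler_sum// => i _.
by rewrite normrM ler_wpM2r// coord_le_norm.
Qed.

Lemma is_derive_inner (R : realType) n (c : R -> 'rV[R]_n) w v :
  is_derive (0 : R) 1 c w -> is_derive (0 : R) 1 (fun t => inner (c t) v) (inner w v).
Proof.
move=> /is_derive_epsP h; apply/is_derive_epsP => e e0.
pose C := \sum_i `|v 0 i| + 1.
have C0 : 0 < C by rewrite ltr_wpDl// sumr_ge0.
have [r r0 hr] := h _ (divr_gt0 e0 C0); exists r => // t /hr ht.
rewrite -[t *: _]/(t * inner w v) -innerZl -!innerNl -!innerDl.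
rewrite (le_trans (abs_inner_le _ _))//.
rewrite (@le_trans _ _ (e / C * `|t| * C))//; last by rewrite mulrAC divfK// gt_eqF.
by apply: ler_pM => //; [exact: sumr_ge0|rewrite /C lerDl].
Qed.

Lemma is_derive_cvg (R : realType) (V : normedModType R) (c : R -> V) v :
  is_derive (0 : R) 1 c v -> (fun t => t^-1 *: (c t - c 0)) @ (0 : R)^' --> v.
Proof.
move=> /is_derive_epsP h; apply/cvgrPdist_le => e e0; have [r r0 hr] := h e e0.
near=> t.
have t0 : t != 0 by near: t; exact: nbhs_dnbhs_neq.
have tr : `|t| < r by near: t; apply: dnbhs0_lt.
have ht := hr _ tr; rewrite distrC -(ler_pM2r (_ : 0 < `|t|)) ?normr_gt0// mulrC -normrZ.
by rewrite scalerBr scalerA mulfV// scale1r.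
Unshelve. all: by end_near. Qed.

Lemma is_derive_continuous (R : realType) (V : normedModType R) (c : R -> V) v :
  is_derive (0 : R) 1 c v -> c @ (0 : R) --> c 0.
Proof. by move=> cv; apply: differentiable_continuous; apply/derivable1_diffP. Qed.

Section second_fundamental_form.
Context {R : realType} {n : nat}.
Variables (G U : set 'rV[R]_n) (phi : 'rV[R]_n -> R).
Hypothesis cG : closed G.
Hypothesis oU : open U.
Hypothesis phi2 : C2_on U phi.
Hypothesis regphi : forall y, U y -> exists v, 'D_v phi y != 0.
Hypothesis GU : G `&` U = [set y | 0 <= phi y] `&` U.

(** With N the normal at [x], the gradient is a multiple of [nu] along the boundary curve, so D_v
    phi times <nu, N> equals <nu, v> times D_N phi there. Both factors containing v vanish at t = 0;
    dividing by t and passing to the limit gives the formula without differentiating the length of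
    the gradient. *)
Lemma second_derive_dnu x d w v : U x -> phi x = 0 -> tangent_vector (boundary G) x d ->
  dnu G x d w -> inner (grad phi x) v = 0 ->
  'D_d ('D_v phi) x = enorm (grad phi x) * inner w v.
Proof.
move=> Ux x0 [c cc] /(_ c cc) dN nv; have [c0 bc dc] := cc.
have dphi y : U y -> differentiable phi y by move=> /phi2[].
have nuE y Uy y0 := @nu_level R n G U phi cG oU dphi regphi GU y Uy y0.
have bE y Uy := @boundary_level R n G U phi cG oU dphi regphi GU y Uy.
set h := enorm (grad phi x).
have h0 : 0 < h by exact: (enorm_grad_gt0 dphi regphi Ux).
have ccont : {for 0, continuous c} by apply: differentiable_continuous; apply/derivable1_diffP.
have Uc : \forall t \near (0 : R), U (c t).
  by apply: ccont; rewrite c0; exact: open_nbhs_nbhs.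
have comp u : is_derive (0 : R) 1 (fun t => 'D_u phi (c t)) ('D_d ('D_u phi) x).
  have := @is_derive_comp_diff _ _ c ('D_u phi) 0 d dc; rewrite c0; apply.
  by have [_ h1 _] := phi2 Ux; exact: h1.
pose N := nu G x.
have N0 : nu G (c 0) = N by rewrite c0.
have NE : N = h^-1 *: grad phi x by exact: nuE.
have nuv := is_derive_inner v dN; have nuN := is_derive_inner N dN.
have cF := is_derive_cvg (comp v); have cg := is_derive_cvg nuv.
have ca : (fun t => inner (nu G (c t)) N) @ 0^' --> inner N N.
  by apply: cvg_within_filter; have := is_derive_continuous nuN; rewrite /= N0.
have cb : (fun t => 'D_N phi (c t)) @ 0^' --> 'D_N phi x.
  by apply: cvg_within_filter; have := is_derive_continuous (comp N); rewrite /= c0.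
have l1 := cvgM cF ca; have l2 := cvgM cg cb.
have E : 'D_d ('D_v phi) x * inner N N = inner w v * 'D_N phi x.
  suff l3 : (fun t => t^-1 *: ('D_v phi (c t) - 'D_v phi (c 0))) \* (fun t => inner (nu G (c t)) N) @ 0^' -->
      inner w v * 'D_N phi x.
    exact: (norm_cvg_unique (l1 _) l3).
  apply: cvg_trans (l2 _); apply: near_eq_cvg; near=> t.
  have Uct : U (c t) by near: t; exact: cvg_within.
  have bct : boundary G (c t) by near: t; exact: cvg_within.
  have pct : phi (c t) = 0 by apply/(bE _ Uct).
  rewrite /= c0 !derive_grad; try exact: dphi.
  rewrite nv -/N [in inner N v]NE innerZl nv mulr0 !subr0 nuE//.
  rewrite !innerZl -[t^-1 *: (_ * _)]/(t^-1 * (_ * _)) -[t^-1 *: inner _ _]/(t^-1 * inner _ _).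
  ring.
move: E; rewrite (derive_grad N (dphi _ Ux)).
rewrite NE innerZl !innerZr -enorm_sqr -/h expr2 mulKf ?gt_eqF// mulVf ?gt_eqF// mulr1 => ->.
by rewrite mulrC.
Unshelve. all: by end_near. Qed.
End second_fundamental_form.

Lemma cvg_sumr (R : realType) T {F : set_system T} {FF : Filter F} (I : Type) (r : seq I)
    (f : I -> T -> R) (a : I -> R) : (forall i, f i t @[t --> F] --> a i) ->
  \sum_(i <- r) f i t @[t --> F] --> \sum_(i <- r) a i.
Proof.
move=> h; elim: r => [|i r IH].
  by rewrite big_nil; under eq_fun do rewrite big_nil; exact: cvg_cst.
by rewrite big_cons; under eq_fun do rewrite big_cons; exact: cvgD.
Qed.

Lemma is_derive_line (R : realType) (V : normedModType R) (x h : V) (s : R) :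
  is_derive s 1 (fun s : R => x + s *: h) h.
Proof.
apply: DeriveDef; first by apply/derivable1_diffP.
by rewrite deriveE// diff_val/= add0r scale1r.
Qed.

(** * Second-order Taylor expansion *)

Section taylor2.
Context {R : realType} {n : nat}.
Variables (U : set 'rV[R]_n) (phi : 'rV[R]_n -> R) (x : 'rV[R]_n).
Hypothesis oU : open U.
Hypothesis Ux : U x.
Hypothesis dphi : forall y, U y -> differentiable phi y.
Hypothesis d2phi : forall v, differentiable ('D_v phi) x.

(** The second derivative of [phi] along [h], written with partial derivatives so that the expansion
    involves the differentials at [x] of n functions that do not depend on [h]. *)
Definition hess (h : 'rV[R]_n) : R := \sum_i h 0 i * 'd ('D_(delta_mx 0 i) phi) x h.

Lemma derive_coord y h : U y -> 'D_h phi y = \sum_i h 0 i * 'D_(delta_mx 0 i) phi y.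
Proof.
move=> Uy; rewrite derive_grad; last exact: dphi.
by apply: eq_bigr => i _; rewrite mxE mulrC.
Qed.

(** The remainder is psi 1 - psi 0. By the mean value theorem it is a value of psi', which is small
    of order |h| ^ 2 by differentiability of the partial derivatives at the single point [x]. *)
Lemma taylor2 (eps : R) : 0 < eps -> exists2 r : R, 0 < r & forall h, `|h| < r ->
  `|phi (x + h) - phi x - 'D_h phi x - hess h / 2| <= eps * `|h| ^+ 2.
Proof.
move=> e0.
have n0 : 0 < n.+1%:R :> R by [].
(* The allowance is shared among the n coordinates; n+1 also covers n = 0. *)
have en : 0 < eps / n.+1%:R by rewrite divr_gt0.
pose g i := 'D_(delta_mx 0 i) phi.
pose P i (h : 'rV[R]_n) := `|g i (x + h) - g i x - 'd (g i) x h| <= eps / n.+1%:R * `|h|.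
have hP i : \forall h \near (0 : 'rV[R]_n), P i h.
  by apply/nbhs0_epsP; have [r r0 hr] := diff_eps (d2phi (delta_mx 0 i)) en; exists r.
have /nbhs0_epsP[r1 r10 h1] : \forall h \near (0 : 'rV[R]_n), forall i, P i h.
  exact: (@filter_forall _ _ P (nbhs (0 : 'rV[R]_n)) _ hP).
have /nbhs_ballP[r2 /= r20 h2] : nbhs x U by exact: open_nbhs_nbhs.
exists (Num.min r1 r2); first by rewrite lt_min r10.
move=> h; rewrite lt_min => /andP[hr1 hr2].
have sh (s : R) : 0 <= s <= 1 -> `|s *: h| <= `|h|.
  by move=> /andP[s0 s1]; rewrite normrZ ger0_norm// ler_piMl.
have Us (s : R) : 0 <= s <= 1 -> U (x + s *: h).
  move=> /sh hs; apply: h2; rewrite -ball_normE /= opprD addrA subrr sub0r normrN.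
  exact: le_lt_trans hr2.
pose psi (s : R) := phi (x + s *: h) - s * 'D_h phi x - s ^+ 2 * (hess h / 2).
pose dpsi (s : R) := 'D_h phi (x + s *: h) - 'D_h phi x - s * hess h.
have dd (s : R) : 0 <= s <= 1 -> is_derive s 1 psi (dpsi s).
  move=> s01.
  have d1 : is_derive s 1 (fun s : R => phi (x + s *: h)) ('D_h phi (x + s *: h)).
    exact: (is_derive_comp_diff (is_derive_line x h s) (dphi (Us _ s01))).
  rewrite /psi /dpsi.
  apply: is_derive_eq.
  rewrite !scaler0 !add0r -[(hess h / 2) *: _]/((hess h / 2) * (s * 1 + s * 1)).
  by rewrite -[('D_h phi x)%:A]/('D_h phi x * 1); field.
have [c c01] : exists2 c, c \in `]0, 1[ & psi 1 - psi 0 = dpsi c * (1 - 0).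
  apply: MVT => [//|s|]; first by rewrite in_itv/= => /andP[s0 s1]; apply: dd; rewrite !ltW.
  apply: continuous_in_subspaceT => s /set_mem/=; rewrite in_itv/= => s01.
  have := dd s s01 => ds.
  by apply: differentiable_continuous; apply/derivable1_diffP.
have {}c01 : 0 <= c <= 1 by move: c01; rewrite in_itv/= => /andP[? ?]; rewrite !ltW.
rewrite /psi scale1r scale0r addr0 !mul1r expr1n mul1r mul0r expr0n mul0r !subr0 mulr1 => E.
have -> : phi (x + h) - phi x - 'D_h phi x - hess h / 2 = dpsi c by rewrite -E; ring.
rewrite /dpsi (derive_coord h (Us _ c01)) (derive_coord h Ux) /hess mulr_sumr -!sumrB.
rewrite (le_trans (ler_norm_sum _ _ _))//.
apply: (@le_trans _ _ (\sum_(i < n) eps / n.+1%:R * `|h| ^+ 2)).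
  apply: ler_sum => i _.
  have -> : h 0 i * 'D_(delta_mx 0 i) phi (x + c *: h) - h 0 i * 'D_(delta_mx 0 i) phi x -
      c * (h 0 i * 'd ('D_(delta_mx 0 i) phi) x h) =
      h 0 i * (g i (x + c *: h) - g i x - 'd (g i) x (c *: h)).
    by rewrite (_ : 'd (g i) x (c *: h) = c * 'd (g i) x h); [rewrite /g; ring|exact: linearZ].
  rewrite normrM expr2 mulrCA ler_pM//; first exact: coord_le_norm.
  apply: (le_trans (h1 _ _ i)); first exact: le_lt_trans (sh _ c01) hr1.
  by rewrite ler_wpM2l ?sh// ltW.
rewrite sumr_const card_ord -[leLHS]mulr_natr mulrAC ler_wpM2r ?sqr_ge0//.
by rewrite mulrAC ler_pdivrMr// ler_pM2l// ler_nat.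
Qed.

Lemma hess_bound : exists2 C : R, 0 <= C & forall h, `|hess h| <= C * `|h| ^+ 2.
Proof.
pose A i j := 'd ('D_(delta_mx 0 i) phi) x (delta_mx 0 j) : R.
exists (\sum_i \sum_j `|A i j|); first by rewrite sumr_ge0// => i _; rewrite sumr_ge0.
move=> h; rewrite /hess (le_trans (ler_norm_sum _ _ _))// mulr_suml ler_sum// => i _.
rewrite normrM {2}(row_sum_delta h) linear_sum (le_trans (ler_wpM2l (normr_ge0 _) (ler_norm_sum _ _ _)))//.
rewrite expr2 mulrA mulr_suml mulr_sumr mulr_suml ler_sum// => j _.
rewrite (_ : 'd _ x (h 0 j *: _) = h 0 j * A i j); last exact: linearZ.
rewrite normrM mulrA -(mulrA `|A i j|) [leRHS]mulrC.
by rewrite ler_wpM2r// ler_pM// coord_le_norm.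
Qed.

Lemma continuous_hess : continuous hess.
Proof.
move=> h; apply: (cvg_sumr (FF := nbhs_filter h)) => i; apply: cvgM.
  exact: coord_continuous.
by apply: diff_continuous; exact: d2phi.
Qed.

(** On all of [U], D_v phi is a fixed linear combination of the partial derivatives, so the second
    derivative at [x] is linear in each of its two directions and [hess] is its diagonal. *)
Lemma hess_frame m (e : 'I_m -> 'rV[R]_n) (a : 'I_m -> R) :
  hess (\sum_i a i *: e i) = \sum_i \sum_j a i * a j * 'D_(e i) ('D_(e j) phi) x.
Proof.
set h := \sum_i a i *: e i.
have De v w : 'D_w ('D_v phi) x = \sum_i v 0 i * 'd ('D_(delta_mx 0 i) phi) x w.
  rewrite (@near_eq_derive _ _ _ _ (\sum_i (v 0 i *: 'D_(delta_mx 0 i) phi))).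
    rewrite derive_sum; last by move=> i; apply: diff_derivable; exact: differentiableZ.
    apply: eq_bigr => i _; rewrite deriveZ; last exact: diff_derivable.
    by rewrite deriveE.
  have := open_nbhs_nbhs (conj oU Ux); apply: filterS => y Uy.
  rewrite (derive_coord v Uy) fct_sumE; exact: eq_bigr.
have -> : hess h = 'D_h ('D_h phi) x by rewrite De.
rewrite deriveE// {2}/h linear_sum; apply: eq_bigr => i _.
rewrite linearZ/= -deriveE// De -[_ *: _]/(_ * _) mulr_sumr.
under eq_bigr do rewrite De mulr_sumr.
rewrite exchange_big; apply: eq_bigr => k _.
rewrite /h summxE mulr_suml mulr_sumr; apply: eq_bigr => j _.
by rewrite mxE; ring.
Qed.

End taylor2.

Lemma boundary_expansion (R : realType) m (K G : set 'rV[R]_m.+1) (x : 'rV[R]_m.+1)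
    (kappa : 'I_m -> R) (e : 'I_m -> 'rV[R]_m.+1) (M : R) :
  (forall y, K y -> `|y| <= M) -> closed G -> C2_boundary G -> boundary G x ->
  principal_curvatures_directions G x kappa e ->
  exists (w : R -> 'rV[R]_m.+1 -> R) (C r0 : R),
  [/\ 0 < r0, 0 <= C,
    forall r y, 0 < r < r0 -> K y ->
      (G (x + r *: y) <-> 0 <= inner y (nu G x) + r * w r y) /\ `|w r y| <= C,
    forall s v, w r ((r * s) *: nu G x + frame e v) @[r --> 0^'+] -->
      - (\sum_i kappa i * v 0 i ^+ 2) / 2 &
    inner (nu G x) (nu G x) = 1 /\ forall i, inner (nu G x) (e i) = 0].
Proof.
move=> KM cG C2G bx [te ee de].
have [U [phi [oU Ux phi2 regphi GU]]] := C2G x bx.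
have dphi y : U y -> differentiable phi y by move=> /phi2[].
have d2phi v : differentiable ('D_v phi) x by have [_ h _] := phi2 x Ux; exact: h.
have x0 : phi x = 0 by apply/(boundary_level cG oU dphi regphi GU Ux).
pose g := enorm (grad phi x).
have g0 : 0 < g by exact: (enorm_grad_gt0 dphi regphi Ux).
have nuE : nu G x = g^-1 *: grad phi x by exact: (nu_level cG oU dphi regphi GU).
have gradE : grad phi x = g *: nu G x by rewrite nuE scalerA mulfV ?scale1r// gt_eqF.
have [nu1 nuT _] : is_inward_unit_normal G x (nu G x).
  by rewrite nuE; exact: (inward_normal_level cG oU dphi regphi GU).
have nue i : inner (nu G x) (e i) = 0 by apply: nuT; exact: te.
have Dphi (r : R) y : 'D_(r *: y) phi x = r * g * inner y (nu G x).
  by rewrite (derive_grad _ (dphi _ Ux)) gradE innerZl innerZr innerC; ring.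
have hessZ (r : R) y : hess phi x (r *: y) = r ^+ 2 * hess phi x y.
  rewrite /hess mulr_sumr; apply: eq_bigr => i _; rewrite mxE.
  by rewrite (_ : 'd _ x (r *: y) = r * 'd ('D_(delta_mx 0 i) phi) x y); [ring|exact: linearZ].
(* Principal directions diagonalize the form: d(nu) sends [e i] to - kappa i [e i], so the mixed
   terms vanish by orthogonality. *)
have hessJ v : hess phi x (frame e v) = - (g * \sum_i kappa i * v 0 i ^+ 2).
  rewrite frame_sum (hess_frame oU Ux dphi d2phi) mulr_sumr -sumrN; apply: eq_bigr => i _.
  under eq_bigr => j _.
    rewrite (second_derive_dnu cG oU phi2 regphi GU Ux x0 (te i) (de i)); last first.
      by rewrite gradE innerZl nue mulr0.
    rewrite innerNl innerZl ee -/g; over.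
  rewrite (bigD1 i)//= big1 ?addr0; first by rewrite eqxx /= mulr1n; ring.
  by move=> j ji; rewrite eq_sym (negPf ji) /= mulr0n; ring.
have [Ch Ch0 hb] := hess_bound phi x.
have taylor := taylor2 oU Ux dphi d2phi.
(* Chosen so that phi (x + r y) = r g (<y, nu> + r w r y) holds exactly; r g > 0 then transfers the
   sign. *)
pose w (r : R) y := (phi (x + r *: y) / (r * g) - inner y (nu G x)) / r.
have [r1 r10 h1] := taylor 1 ltr01.
have /nbhs0_epsP[r2 r20 h2] : \forall h \near (0 : 'rV[R]_m.+1), U (x + h).
  have [r r0 hr] := (nbhs_ballP _ _).1 (open_nbhs_nbhs (conj oU Ux)).
  apply/nbhs0_epsP; exists r => // h hlt; apply: hr.
  by rewrite -ball_normE /= opprD addrA subrr sub0r normrN.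
pose M' := `|M| + 1; have M'0 : 0 < M' by rewrite ltr_wpDl.
have wE (r : R) y : 0 < r -> w r y =
    (phi (x + r *: y) - phi x - 'D_(r *: y) phi x - hess phi x (r *: y) / 2) / (r ^+ 2 * g) +
    hess phi x y / (2 * g).
  move=> r0; rewrite /w x0 Dphi hessZ; field.
  by rewrite !gt_eqF.
(* Ch / 2 comes from the quadratic term and 1 from the Taylor remainder with precision 1; the radius
   keeps r y within reach of both [U] and the expansion for all y in [K]. *)
exists w, ((Ch / 2 + 1) * M' ^+ 2 / g), (Num.min r1 r2 / M'); split.
- by rewrite divr_gt0// lt_min r10.
- by rewrite divr_ge0 ?(ltW g0)// mulr_ge0 ?exprn_ge0 ?(ltW M'0)// addr_ge0// divr_ge0.
- move=> r y /andP[r0]; rewrite ltr_pdivlMr// lt_min => /andP[hr1 hr2] Ky.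
  have yM : `|y| <= M' by rewrite (le_trans (KM _ Ky))// (le_trans (ler_norm M))// lerDl.
  have ryM : `|r *: y| <= r * M' by rewrite normrZ gtr0_norm// ler_pM2l.
  have Ury : U (x + r *: y) by apply: h2; exact: le_lt_trans hr2.
  have rg : 0 < r * g by rewrite mulr_gt0.
  split.
    rewrite (level_setE GU Ury).
    have -> : inner y (nu G x) + r * w r y = phi (x + r *: y) / (r * g).
      by rewrite /w; field; rewrite !gt_eqF.
    by rewrite pmulr_lge0// invr_gt0.
  have := h1 _ (le_lt_trans ryM hr1); rewrite mul1r => T.
  rewrite wE// (le_trans (ler_normD _ _))//.
  have y2 : `|y| ^+ 2 <= M' ^+ 2 by rewrite lerXn2r ?nnegrE// ltW.
  have a1 : `|(phi (x + r *: y) - phi x - 'D_(r *: y) phi x - hess phi x (r *: y) / 2) / (r ^+ 2 * g)| <= M' ^+ 2 / g.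
    rewrite normrM normfV [`|r ^+ 2 * g|]gtr0_norm ?mulr_gt0// ?exprn_gt0//.
    rewrite ler_pdivrMr ?mulr_gt0 ?exprn_gt0// (le_trans T)//.
    rewrite normrZ gtr0_norm// exprMn.
    have -> : M' ^+ 2 / g * (r ^+ 2 * g) = r ^+ 2 * M' ^+ 2 by field; rewrite gt_eqF.
    by rewrite ler_pM2l// exprn_gt0.
  have a2 : `|hess phi x y / (2 * g)| <= Ch / 2 * M' ^+ 2 / g.
    rewrite normrM normfV [`|2 * g|]gtr0_norm ?mulr_gt0// ler_pdivrMr ?mulr_gt0//.
    have -> : Ch / 2 * M' ^+ 2 / g * (2 * g) = Ch * M' ^+ 2 by field; rewrite gt_eqF.
    by rewrite (le_trans (hb _))// ler_wpM2l.
  by rewrite (_ : (Ch / 2 + 1) * M' ^+ 2 / g = M' ^+ 2 / g + Ch / 2 * M' ^+ 2 / g); [exact: lerD|ring].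
- move=> s v.
  set N := nu G x; pose y (r : R) := (r * s) *: N + frame e v.
  have cy : y @ 0^'+ --> frame e v.
    apply: cvg_within_filter.
    have := @cvg_line R _ (frame e v) (s *: N); rewrite /y.
    by under eq_fun do rewrite scalerA addrC.
  have -> : - (\sum_i kappa i * v 0 i ^+ 2) / 2 = 0 + hess phi x (frame e v) / (2 * g).
    by rewrite hessJ; field; rewrite gt_eqF.
  pose E (r : R) := (phi (x + r *: y r) - phi x - 'D_(r *: y r) phi x - hess phi x (r *: y r) / 2) / (r ^+ 2 * g).
  apply: (@cvg_trans _ (E r + hess phi x (y r) / (2 * g) @[r --> 0^'+])).
    apply: near_eq_cvg; apply/near0_rightP; exists 1 => // r r0 _.
    by rewrite -/(y r) wE.
  apply: cvgD; last first.
    apply: cvgM; last exact: cvg_cst.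
    exact: (cvg_comp _ _ cy (@continuous_hess _ _ _ _ d2phi (frame e v))).
  pose B := `|s| * `|N| + `|frame e v| + 1.
  have B0 : 0 < B by rewrite ltr_wpDl// addr_ge0// mulr_ge0.
  apply/cvgr0Pnorm_le => eps eps0; apply/near0_rightP.
  (* [B] bounds |y r| for r <= 1, so the remainder at this precision, divided by r ^ 2 g, is at most
     eps. *)
  have e1 : 0 < eps * g / B ^+ 2 by rewrite divr_gt0 ?exprn_gt0// mulr_gt0.
  have [r3 r30 h3] := taylor _ e1.
  exists (Num.min 1 (r3 / B)); first by rewrite lt_min ltr01 divr_gt0.
  move=> r r0; rewrite lt_min ltr_pdivlMr// => /andP[rl1 rB].
  have yB : `|y r| <= B.
    rewrite (le_trans (ler_normD _ _))// normrZ normrM gtr0_norm// /B -addrA lerD//.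
      by rewrite -mulrA ler_piMl ?mulr_ge0// ltW.
    by rewrite lerDl.
  have ryB : `|r *: y r| <= r * B by rewrite normrZ gtr0_norm// ler_pM2l.
  have T := h3 _ (le_lt_trans ryB rB).
  rewrite /E normrM normfV [`|r ^+ 2 * g|]gtr0_norm ?mulr_gt0// ?exprn_gt0//.
  rewrite ler_pdivrMr ?mulr_gt0 ?exprn_gt0// (le_trans T)//.
  have b2 : `|r *: y r| ^+ 2 <= (r * B) ^+ 2 by rewrite lerXn2r ?nnegrE// mulr_ge0 ?ltW.
  rewrite (le_trans (ler_wpM2l (ltW e1) b2))//.
  by rewrite le_eqVlt; apply/orP; left; apply/eqP; field; rewrite gt_eqF.
- by [].
Qed.

(** * The layer along the tangent hyperplane *)

Lemma convex_comb (R : realType) n (K : set 'rV[R]_n) (a b : 'rV[R]_n) (t : R) :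
  convex_set K -> 0 <= t <= 1 -> K a -> K b -> K (t *: a + (1 - t) *: b).
Proof.
move=> cK t01 Ka Kb; have /andP[t0 t1] := t01.
have := cK a b (Itv01 t0 t1) (mem_set Ka) (mem_set Kb).
by move=> /set_mem.
Qed.

(** Bernoulli's inequality. *)
Lemma one_sub_expn (R : realType) (x : R) m : 0 <= x <= 1 -> 1 - m%:R * x <= (1 - x) ^+ m.
Proof.
move=> /andP[x0 x1]; elim: m => [|m IH]; first by rewrite mul0r subr0 expr0.
rewrite exprS; have x1' : 0 <= 1 - x by lra.
apply: (le_trans _ (ler_wpM2l x1' IH)).
have : 0 <= m%:R * x * x by rewrite !mulr_ge0.
rewrite -natr1; move: m%:R => y h; lra.
Qed.

(* The boundary of a star-shaped set of finite measure is negligible on the set itself: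
   shrinking the set by [t < 1] multiplies its measure by [t ^+ m]. *)
Lemma star_shell_null (R : realType) m (A : set 'rV[R]_m) : measurable A ->
  (lebesgue_rV R m A < +oo)%E ->
  (forall v t, 0 <= t <= 1 -> A v -> A (t *: v)) ->
  lebesgue_rV R m (A `\` \bigcup_k ((fun v => (1 + k.+1%:R^-1) *: v) @^-1` A)) = 0%E.
Proof.
move=> mA Aoo star; set L := lebesgue_rV R m; set B := _ `\` _.
pose l k : R := 1 + k.+1%:R^-1.
have l1 k : 1 < l k by rewrite ltrDl invr_gt0.
have l0 k : 0 < l k by rewrite (lt_trans _ (l1 k)).
have ms k : measurable ((fun v => l k *: v) @^-1` A).
  have mf : measurable_fun setT (fun v : 'rV[R]_m => l k *: v).
    under eq_fun do rewrite -mul_mx_scalar; exact: measurable_fun_linear_rV.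
  by rewrite -[X in measurable X]setTI; exact: mf.
have mB : measurable B by apply: measurableD => //; apply: bigcup_measurable => k _; exact: ms.
have LA k : L ((fun v => l k *: v) @^-1` A) = (((l k)^-1 ^+ m)%:E * L A)%E.
  rewrite -lebesgue_rV_scale ?invr_gt0//; congr (L _); apply/seteqP; split => [v Av|_ [v Av <-]] /=.
    by exists (l k *: v) => //; rewrite scalerA mulVf ?scale1r// gt_eqF.
  by rewrite scalerA mulfV ?scale1r// gt_eqF.
(* The shell and each shrunken copy of [A] are disjoint subsets of [A]. *)
have Bk k : (L B + ((l k)^-1 ^+ m)%:E * L A <= L A)%E.
  rewrite -LA -measureU//; last first.
    by rewrite -subset0 => v [[_ nB] lv]; apply: nB; exists k.
  apply: le_measure; rewrite ?inE//; first exact: measurableU.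
  move=> v [[]//|/= lv]; rewrite -[v]scale1r -(mulVf (lt0r_neq0 (l0 k))) -scalerA.
  by apply: star => //; rewrite invr_ge0 ltW//= invf_le1// ltW.
move: Aoo Bk; have : (0 <= L A)%E by exact: measure_ge0.
have : (0 <= L B)%E by exact: measure_ge0.
case: (L A) => [c||]//; case: (L B) => [b||]//; rewrite !lee_fin => b0 c0 _ Bk; last by have := Bk 0%N; rewrite -EFinM.
have bk k : b <= m%:R * c * k.+1%:R^-1.
  have := Bk k; rewrite -EFinM -EFinD lee_fin => h.
  have k0 : 0 < k.+1%:R :> R by [].
  (* Indeed (k+1)/(k+2) = 1 - 1/(k+2), the form to which Bernoulli's inequality applies. *)
  have lk : (l k)^-1 = 1 - k.+2%:R^-1.
    rewrite /l -[k.+2%:R]natr1; field.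
    by have kk := ler0n R k; apply/andP; split; apply: lt0r_neq0; lra.
  have k2 : 0 <= (k.+2%:R^-1 : R) <= 1 by rewrite invr_ge0 ler0n invf_le1// ler1n.
  have := one_sub_expn m k2; rewrite -lk => hp.
  have hp' := ler_wpM2r c0 hp.
  have kk : k.+2%:R^-1 <= k.+1%:R^-1 :> R by rewrite lef_pV2 ?posrE// ler_nat.
  have mc : 0 <= m%:R * c by rewrite mulr_ge0.
  have := ler_wpM2l mc kk; move: hp' h; rewrite -/(l k).
  by move: (k.+2%:R^-1) (k.+1%:R^-1) ((l k)^-1 ^+ m) => y z P; lra.
congr EFin; apply/eqP; rewrite eq_le b0 andbT leNgt; apply/negP => b1.
have mc1 : 0 < m%:R * c + 1 by rewrite ltr_wpDl// mulr_ge0.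
have [k _ /(_ k (leqnn k))/= hk] := near_infty_natSinv_lt (PosNum (divr_gt0 b1 mc1)).
have := bk k; rewrite ltr_pdivlMr// in hk.
have k0 : 0 < k.+1%:R^-1 :> R by rewrite invr_gt0.
by move: hk k0; move: (k.+1%:R^-1) => z; lra.
Qed.

Lemma indic_sub_le1 (R : realType) T (A B : set T) v : `|\1_A v - \1_B v : R| <= 1.
Proof. by rewrite !indicE; do 2 case: (_ \in _); rewrite ?subrr ?subr0 ?sub0r ?normrN ?normr0 ?normr1. Qed.

Lemma eq_indic (R : realType) T (A B : set T) u v : (A u <-> B v) -> \1_A u = \1_B v :> R.
Proof. by move=> AB; rewrite !indicE (_ : (u \in A) = (v \in B))//; apply/idP/idP => /set_mem h; exact/mem_set/AB. Qed.

Lemma notin_indic (R : realType) T (A : set T) v : ~ A v -> \1_A v = 0 :> R.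
Proof. by move=> Av; rewrite indicE memNset. Qed.

Lemma mem_indic (R : realType) T (A : set T) v : A v -> \1_A v = 1 :> R.
Proof. by move=> Av; rewrite indicE mem_set. Qed.

Section layer.
Context {R : realType} {m : nat}.
Variables (u : 'rV[R]_m.+1) (e : 'I_m -> 'rV[R]_m.+1).
Hypothesis u1 : inner u u = 1.
Hypothesis ue : forall i, inner u (e i) = 0.
Hypothesis ee : forall i j, inner (e i) (e j) = (i == j)%:R.
Variables (K : set 'rV[R]_m.+1) (M : R).
Hypothesis clK : closed K.
Hypothesis convK : convex_set K.
Hypothesis K0 : K° 0.
Hypothesis KM : forall y, K y -> enorm y <= M.
Variables (P : R -> set 'rV[R]_m.+1) (w : R -> 'rV[R]_m.+1 -> R) (C r0 : R) (q : 'rV[R]_m -> R).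
Hypothesis r00 : 0 < r0.
Hypothesis mP : forall r, measurable (P r).
Hypothesis hw : forall r y, 0 < r < r0 -> K y ->
  (P r y <-> 0 <= inner y u + r * w r y) /\ `|w r y| <= C.
Hypothesis hq : forall s v, w r ((r * s) *: u + frame e v) @[r --> 0^'+] --> q v.
Hypothesis mq : measurable_fun setT q.

Let L := lebesgue_rV R m.+1.
(* [T r (s, v) = r s u + frame e v] stretches to unit size the layer of thickness [O(r)] around
   [hyperplane u] outside of which [P r] and the half-space agree on [K]. *)
Let T r v : 'rV[R]_m.+1 := (scale_head r v : 'rV[R]_(1 + m)) *m full_frame u e.
Let tl (v : 'rV[R]_m.+1) : 'rV[R]_m := (rV_uncons v).2.
Let D := `|M| + `|C| + 1.
Let B := [set v : 'rV[R]_m.+1 | forall i, v 0 i \in `[- D, D]].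

Let mK : measurable K.
Proof. exact: closed_measurable_rV. Qed.

Let T_cons r s v : T r (rV_cons (s, v)) = (r * s) *: u + frame e v.
Proof.
rewrite -full_frameE /T; congr (_ *m _); apply/rowP => i; rewrite mxE.
case: (unliftP ord0 i) => [j ->|->]; first by rewrite !rV_consS.
by rewrite eqxx !rV_cons0.
Qed.

Let TE r v : T r v = (r * v 0 ord0) *: u + frame e (tl v).
Proof. by rewrite -{1}[v]rV_unconsK T_cons. Qed.

Let inner_T r v : inner (T r v) u = r * v 0 ord0.
Proof. by rewrite TE innerDl innerZl u1 mulr1 inner_frameu ?addr0. Qed.

Let enorm_T r v : enorm (T r v) = enorm (scale_head r v).
Proof.
rewrite /enorm !innerE /T trmx_mul mulmxA -(mulmxA _ (full_frame u e)).
by rewrite full_frameK// mulmx1.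
Qed.

Let mT r : measurable_fun setT (T r).
Proof. exact: (measurableT_comp (measurable_fun_linear_rV _) (measurable_scale_head r)). Qed.

Let mTA r A : measurable A -> measurable (T r @^-1` A).
Proof. by move=> mA; rewrite -[X in measurable X]setTI; exact: mT. Qed.

Let volT r A : 0 < r -> measurable A -> L A = (r%:E * L (T r @^-1` A))%E.
Proof.
move=> r0' mA; rewrite -(lebesgue_rV_rot (full_frameK u1 ue ee) mA).
rewrite (lebesgue_rV_scale_head r0')//.
by rewrite -[X in measurable X]setTI; exact: measurable_fun_linear_rV.
Qed.

Let H := half_space u.

Let mH : measurable H.
Proof.
rewrite (_ : H = (fun v => inner v u) @^-1` [set` `[0, +oo[]); last first.
  by apply/seteqP; split => v; rewrite /H /half_space /= in_itv/= andbT.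
rewrite -[X in measurable X]setTI.
have mi : measurable_fun setT (fun v : 'rV[R]_m.+1 => inner v u).
  by apply: measurable_inner => //; exact: measurable_cst.
by apply: mi => //; exact: measurable_itv.
Qed.

Let f r v : R := \1_(T r @^-1` (K `&` P r)) v - \1_(T r @^-1` (K `&` H)) v.

Let PTE r v : 0 < r < r0 -> K (T r v) -> P r (T r v) <-> 0 <= v 0 ord0 + w r (T r v).
Proof.
move=> rr Kv; have [-> _] := hw rr Kv; move/andP: rr => [r1 _].
by rewrite inner_T -mulrDr pmulr_rge0.
Qed.

Let HTE r v : 0 < r -> H (T r v) <-> 0 <= v 0 ord0.
Proof. by move=> r1; rewrite /H /half_space/= inner_T pmulr_rge0. Qed.

(** Outside the cube [B], either a tangential coordinate exceeds [M] and [T r v] is not in [K], or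
    |v_0| > C and the correction [w], bounded by C, cannot change the sign of v_0, so both sets
    agree at the point. *)
Let f_le r v : 0 < r < r0 -> `|f r v| <= \1_B v.
Proof.
move=> rr; have [Bv|nBv] := pselect (B v); first by rewrite (mem_indic _ Bv); exact: indic_sub_le1.
rewrite (notin_indic _ nBv) normr_le0 subr_eq0; apply/eqP.
have [Kv|nKv] := pselect (K (T r v)); last by rewrite !notin_indic// => -[].
have r1 : 0 < r by case/andP: rr.
suff PH : P r (T r v) <-> H (T r v) by apply: eq_indic; split => -[? ?]; split => //=; apply/PH.
rewrite PTE// HTE//; have [_ wC] := hw rr Kv.
have DM : `|M| <= D by rewrite /D -addrA lerDl addr_ge0.
have DC : `|C| <= D by rewrite /D addrAC lerDr addr_ge0.
have v0D : D < `|v 0 ord0|.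
  rewrite ltNge; apply/negP => v0D; apply: nBv => i; rewrite in_itv/= -ler_norml.
  case: (unliftP ord0 i) => [j ->|->//].
  have := coord_le_enorm (scale_head r v) (lift ord0 j); rewrite mxE eq_sym (negPf (neq_lift _ _)) => h.
  by rewrite (le_trans h)// -enorm_T (le_trans (KM Kv))// (le_trans (ler_norm M)).
move: wC; rewrite ler_norml => /andP[w1 w2].
move: v0D; have CD : C <= D by rewrite (le_trans (ler_norm C)).
have [v0|v0] := lerP 0 (v 0 ord0).
  by rewrite ger0_norm// => v0D; split => // _; lra.
by rewrite ltr0_norm// => v0D; split => ?; exfalso; lra.
Qed.

Let K1 := frame e @^-1` K.
(** In the limit, [PP] is what is gained with respect to the half-space and [QQ] what is lost: the
    fibre over v is [-q v, 0) when q v > 0 and [0, -q v) when q v < 0. *)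
Let PP := [set v | [/\ K1 (tl v), v 0 ord0 < 0 & 0 <= v 0 ord0 + q (tl v)]].
Let QQ := [set v | [/\ K1 (tl v), 0 <= v 0 ord0 & v 0 ord0 + q (tl v) < 0]].
Let g v : R := \1_PP v - \1_QQ v.
Let shell := K1 `\` \bigcup_k ((fun v => (1 + k.+1%:R^-1) *: v) @^-1` K1).

(** If l v remains in the section for some l > 1, then [frame e v] is a convex combination of a
    point of [K] and the interior point 0 with weight 1 - 1/l > 0 on 0; a ball of radius r around 0
    in [K] gives one of radius r (1 - 1/l). *)
Let nbhsK v : K1 v -> ~ shell v -> nbhs (frame e v) K.
Proof.
move=> K1v nsv; have [k Kk] : exists k, K1 ((1 + k.+1%:R^-1) *: v).
  apply: contrapT => h; apply: nsv; split => // -[k _ Kk]; apply: h; by exists k.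
set l := 1 + _ in Kk.
have l1 : 1 < l by rewrite ltrDl invr_gt0.
have l0 : 0 < l by rewrite (lt_trans _ l1).
have t0 : 0 < 1 - l^-1 by rewrite subr_gt0 invf_lt1.
have /nbhs0_epsP[r r1 hr] : \forall h \near (0 : 'rV[R]_m.+1), K h by exact: K0.
apply/nbhs_ballP; exists (r * (1 - l^-1)); first by rewrite /= mulr_gt0.
move=> z; rewrite -ball_normE /= => hz.
have -> : z = l^-1 *: frame e (l *: v) + (1 - l^-1) *: ((1 - l^-1)^-1 *: (z - frame e v)).
  rewrite {1}/frame -scalemxAl !scalerA mulVf ?gt_eqF// mulfV ?gt_eqF// !scale1r -/(frame e v).
  by rewrite addrC subrK.
apply: convex_comb => //; first by rewrite invr_ge0 (ltW l0)/= invf_le1// ltW.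
apply: hr; rewrite normrZ gtr0_norm ?invr_gt0// ltr_pdivrMl// mulrC distrC//.
Qed.

(** Off the two exceptional sets every condition stabilizes as r tends to 0: membership in [K]
    because [frame e (tl v)] is interior to [K] or in its open complement, and the sign of v_0 + w
    because its limit is nonzero. *)
Let near_f (v : 'rV[R]_m.+1) : v 0 ord0 + q (tl v) != 0 -> ~ shell (tl v) ->
  \forall r \near 0^'+, f r v = g v.
Proof.
move=> v0 nsv.
have cT : T r v @[r --> 0^'+] --> frame e (tl v).
  apply: cvg_within_filter.
  have := @cvg_line R _ (frame e (tl v)) (v 0 ord0 *: u).
  by under eq_fun do rewrite scalerA addrC -TE.
have rr : \forall r \near 0^'+, 0 < r < r0.
  by apply/near0_rightP; exists r0 => // r -> ->.
have [K1v|nK1v] := pselect (K1 (tl v)); last first.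
  have nK : \forall r \near 0^'+, ~ K (T r v).
    have nb : nbhs (frame e (tl v)) (~` K).
      by apply: open_nbhs_nbhs; split => //; exact: closed_openC.
    exact: (cT _ nb).
  near=> r; rewrite /f /g !notin_indic//.
  - by move=> [].
  - by move=> [].
  - by move=> [Kr _]; move: Kr; near: r.
  - by move=> [Kr _]; move: Kr; near: r.
have hK : \forall r \near 0^'+, K (T r v) by exact: (cT _ (nbhsK K1v nsv)).
have cw : v 0 ord0 + w r (T r v) @[r --> 0^'+] --> v 0 ord0 + q (tl v).
  apply: cvgD; first exact: cvg_cst.
  by under eq_fun do rewrite TE; exact: hq.
case: (ltgtP (v 0 ord0 + q (tl v)) 0) v0 => // v0 _.
  have hv : \forall r \near 0^'+, v 0 ord0 + w r (T r v) < 0.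
    exact: (@cvgr_lt _ _ _ _ (fun r => v 0 ord0 + w r (T r v)) _ cw _ v0).
  near=> r; have r1 : 0 < r < r0 by near: r.
  have Kr : K (T r v) by near: r.
  have : v 0 ord0 + w r (T r v) < 0 by near: r.
  move=> wr; rewrite /f /g; congr (_ - _).
    rewrite !notin_indic//; first by move=> [_ _]; rewrite leNgt v0.
    by move=> [_ /(PTE r1 Kr)]; rewrite leNgt wr.
  apply: eq_indic; case/andP: r1 => r1 _; split => [[_ /(HTE _ r1)//]|[_ h _]].
  by split => //; apply/HTE.
have hv : \forall r \near 0^'+, 0 < v 0 ord0 + w r (T r v).
  exact: (@cvgr_gt _ _ _ _ (fun r => v 0 ord0 + w r (T r v)) _ cw _ v0).
near=> r; have r1 : 0 < r < r0 by near: r.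
have Kr : K (T r v) by near: r.
have : 0 < v 0 ord0 + w r (T r v) by near: r.
move=> wr; rewrite /f /g (@mem_indic R _ (T r @^-1` (K `&` P r)) v); last first.
  by split => //; apply/(PTE r1 Kr); exact: ltW.
rewrite (@notin_indic R _ QQ v) ?subr0; last by move=> [_ _]; rewrite ltNge (ltW v0).
have r2 : 0 < r by case/andP: r1.
have [v00|v00] := lerP 0 (v 0 ord0).
  rewrite mem_indic ?notin_indic ?subrr//; first by move=> [_]; rewrite ltNge v00.
  by split => //; apply/HTE.
rewrite notin_indic ?mem_indic ?subr0//; first by split => //; exact: ltW.
by move=> [_ /(HTE _ r2)]; rewrite leNgt v00.
Unshelve. all: by end_near. Qed.

Let mtl : measurable_fun setT tl.
Proof. exact: (measurableT_comp measurable_snd measurable_rV_uncons). Qed.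

Let mK1 : measurable K1.
Proof. by rewrite -[X in measurable X]setTI; exact: measurable_frame. Qed.

Let K1M v : K1 v -> enorm v <= M.
Proof. by move=> /KM; rewrite (enorm_frame ee). Qed.

Let shell0 : lebesgue_rV R m shell = 0%E.
Proof.
apply: star_shell_null => //.
  apply: (lebesgue_rV_bounded (M := M)) => // v /K1M vM i.
  exact: le_trans (coord_le_enorm _ _) vM.
move=> v t t01 Kv; rewrite /K1 /= /frame -scalemxAl -[_ *: _]addr0 -(scaler0 _ (1 - t)).
apply: convex_comb => //; exact: interior_subset.
Qed.

Let mg1 : measurable_fun setT (fun v : 'rV[R]_m.+1 => v 0 ord0 + q (tl v)).
Proof.
apply: measurable_funD; last exact: (measurableT_comp mq mtl).
exact: (measurable_rV_coord (ord0 : 'I_m.+1)).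
Qed.

Let mpre (h : 'rV[R]_m.+1 -> R) (I : interval R) : measurable_fun setT h ->
  measurable [set v | h v \in I].
Proof.
move=> mh; rewrite (_ : mkset _ = h @^-1` [set` I])// -[X in measurable X]setTI.
by apply: mh => //; exact: measurable_itv.
Qed.

Let mtlK1 A : measurable A -> measurable [set v | A (tl v)].
Proof. by move=> mA; rewrite -[X in measurable X]setTI; exact: mtl. Qed.

Let mPP : measurable PP.
Proof.
rewrite (_ : PP = [set v | K1 (tl v)] `&` [set v : 'rV[R]_m.+1 | rV_coord ord0 v \in `]-oo, 0[] `&`
   [set v : 'rV[R]_m.+1 | v 0 ord0 + q (tl v) \in `[0, +oo[]).
  apply: measurableI; last exact: mpre.
  by apply: measurableI; [exact: mtlK1|apply: mpre; exact: measurable_rV_coord].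
apply/seteqP; split => v; rewrite /PP/= !in_itv/= andbT; first by case.
by move=> [[]].
Qed.

Let mQQ : measurable QQ.
Proof.
rewrite (_ : QQ = [set v | K1 (tl v)] `&` [set v : 'rV[R]_m.+1 | rV_coord ord0 v \in `[0, +oo[] `&`
   [set v : 'rV[R]_m.+1 | v 0 ord0 + q (tl v) \in `]-oo, 0[]).
  apply: measurableI; last exact: mpre.
  by apply: measurableI; [exact: mtlK1|apply: mpre; exact: measurable_rV_coord].
apply/seteqP; split => v; rewrite /QQ/= !in_itv/= andbT; first by case.
by move=> [[]].
Qed.

Let sections A : measurable A ->
  (L A = \int[lebesgue_rV R m]_v @lebesgue_measure R [set s | A (rV_cons (s, v))])%E.
Proof.
move=> mA; have mA' : measurable (rV_cons @^-1` A).
  by rewrite -[X in measurable X]setTI; exact: measurable_rV_cons.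
rewrite -(integral_xsection_ysection _ _ mA') /L /= /lebesgue_succ /pushforward /product_measure1.
by apply: eq_integral => s _; rewrite /= xsectionE.
Qed.

Let tl_cons s v : tl (rV_cons (s, v)) = v.
Proof. by rewrite /tl rV_consK. Qed.

(** The bound on [w] passes to the limit along s = 0, where the point is [frame e v] itself and lies
    in [K] for every r. *)
Let qC v : K1 v -> `|q v| <= C.
Proof.
move=> K1v; rewrite leNgt; apply/negP => qv.
have hw0 : `|w r (frame e v)| @[r --> 0^'+] --> `|q v|.
  apply: cvg_norm; have := @hq 0 v.
  by under eq_fun do rewrite mulr0 scale0r add0r.
have : \forall r \near 0^'+, C < `|w r (frame e v)|.
  exact: (@cvgr_gt _ _ _ _ (fun r => `|w r (frame e v)|) _ hw0 _ qv).
move=> /near0_rightP[r r1 hr].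
pose s := Num.min r r0 / 2; have s0 : 0 < s by rewrite divr_gt0// lt_min r1.
have slt : s < Num.min r r0 by rewrite ltr_pdivrMr// mulr_natr mulr2n ltrDl lt_min r1.
move: slt; rewrite lt_min => /andP[s1 s2].
have s02 : 0 < s < r0 by rewrite s0.
have [_] := hw s02 K1v.
by rewrite leNgt hr.
Qed.

Let B_of (v : 'rV[R]_m.+1) : K1 (tl v) -> `|v 0 ord0| <= C -> B v.
Proof.
move=> K1v v0 i; rewrite in_itv/= -ler_norml.
have DM : `|M| <= D by rewrite /D -addrA lerDl addr_ge0.
have DC : `|C| <= D by rewrite /D addrAC lerDr addr_ge0.
case: (unliftP ord0 i) => [j ->|->]; last by rewrite (le_trans v0)// (le_trans (ler_norm C)).
have := coord_le_enorm (tl v) j; rewrite mxE => h.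
by rewrite (le_trans h)// (le_trans (K1M K1v))// (le_trans (ler_norm M)).
Qed.

Let mB : measurable B.
Proof. exact: (measurable_box (fun=> BLeft _) (fun=> BRight _)). Qed.

Let LB : (L B < +oo)%E.
Proof. by rewrite /L lebesgue_rV_symbox ?ltry// => _; rewrite ltr_wpDl// addr_ge0. Qed.

Let LPP : (L PP < +oo)%E.
Proof.
apply: le_lt_trans LB; apply: le_measure; rewrite ?inE// => v [K1v v0 vq].
apply: B_of => //; have := qC K1v; rewrite !ler_norml => /andP[? ?].
by apply/andP; split; lra.
Qed.

Let LQQ : (L QQ < +oo)%E.
Proof.
apply: le_lt_trans LB; apply: le_measure; rewrite ?inE// => v [K1v v0 vq].
apply: B_of => //; have := qC K1v; rewrite !ler_norml => /andP[? ?].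
by apply/andP; split; lra.
Qed.

Let integrable_ind A : measurable A -> (L A < +oo)%E -> L.-integrable setT (EFin \o \1_A).
Proof.
move=> mA LA; apply/integrableP; split; first exact/measurable_EFinP/measurable_indic.
under eq_integral do rewrite /= ger0_norm//.
by rewrite integral_indic// setIT.
Qed.

Let integral_ind2 A A' : measurable A -> measurable A' -> (L A < +oo)%E -> (L A' < +oo)%E ->
  (\int[L]_v (\1_A v - \1_A' v)%:E = L A - L A')%E.
Proof.
move=> mA mA' LA LA'; rewrite -[in RHS](setIT A) -[in RHS](setIT A') -!integral_indic//.
by rewrite -integralB_EFin//; exact: integrable_ind.
Qed.

(** Fibrewise, [PP] has length the positive part of q and [QQ] the negative part. *)
Let integral_g : (\int[L]_v (g v)%:E = \int[lebesgue_rV R m]_(v in K1) (q v)%:E)%E.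
Proof.
rewrite integral_ind2// !sections// [in RHS]integral_mkcond [in RHS]integralE.
congr (_ - _)%E; apply: eq_integral => v _.
  rewrite funepos.unlock /= patchE; case: ifPn => [/set_mem Kv|/negP Kv].
    have [q0|q0] := leP 0%E (q v)%:E.
      rewrite (_ : mkset _ = [set` `[- q v, 0[]).
        rewrite lebesgue_measure_itv/= lte_fin oppr_lt0 -EFinB sub0r opprK.
        case: ifPn => //; rewrite -leNgt => q1; congr EFin; apply/eqP.
        by rewrite eq_le q1 andbT -lee_fin.
      apply/seteqP; split => s; rewrite /PP /= tl_cons rV_cons0 in_itv/=.
        by move=> [_ s0 sq]; apply/andP; split => //; lra.
      by move=> /andP[s1 s2]; split => //; lra.
    rewrite (_ : mkset _ = set0) ?measure0// -subset0 => s.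
    by rewrite /PP /= tl_cons rV_cons0 => -[_ s0 sq]; move: q0; rewrite lte_fin; lra.
  rewrite maxxx (_ : mkset _ = set0) ?measure0// -subset0 => s.
  by rewrite /PP /= tl_cons => -[K1v _ _]; apply: Kv; exact/mem_set.
rewrite funeneg.unlock /= patchE; case: ifPn => [/set_mem Kv|/negP Kv].
  have [q0|q0] := leP 0%E (- (q v)%:E)%E.
    rewrite (_ : mkset _ = [set` `[0, - q v[]).
      rewrite lebesgue_measure_itv/= lte_fin -EFinB subr0.
      case: ifPn => //; rewrite -leNgt => q1; congr EFin; apply/eqP.
      by rewrite eq_le q1 andbT -lee_fin.
    apply/seteqP; split => s; rewrite /QQ /= tl_cons rV_cons0 in_itv/=.
      by move=> [_ s0 sq]; apply/andP; split => //; lra.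
    by move=> /andP[s1 s2]; split => //; lra.
  rewrite (_ : mkset _ = set0) ?measure0// -subset0 => s.
  by rewrite /QQ /= tl_cons rV_cons0 => -[_ s0 sq]; move: q0; rewrite -EFinN lte_fin; lra.
rewrite oppe0 maxxx (_ : mkset _ = set0) ?measure0// -subset0 => s.
by rewrite /QQ /= tl_cons => -[K1v _ _]; apply: Kv; exact/mem_set.
Qed.

Let LK : (L K < +oo)%E.
Proof.
apply: (lebesgue_rV_bounded (M := M)) => // v /KM vM i.
exact: le_trans (coord_le_enorm _ _) vM.
Qed.

Let vT r A : 0 < r -> measurable A -> A `<=` K -> L (T r @^-1` A) = (fine (L A) / r)%:E.
Proof.
move=> r1 mA AK; have LA : L A \is a fin_num.
  rewrite ge0_fin_numE//; apply: le_lt_trans LK; apply: le_measure; rewrite ?inE//.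
apply: (mule_pinj r1); rewrite -volT// -EFinM mulrCA mulfV ?gt_eqF// mulr1 fineK//.
Qed.

Let integral_f r : 0 < r ->
  (\int[L]_v (f r v)%:E = ((fine (L (K `&` P r)) - fine (L (K `&` H))) / r)%:E)%E.
Proof.
move=> r1; have mA1 : measurable (K `&` P r) by exact: measurableI.
have mA2 : measurable (K `&` H) by exact: measurableI.
rewrite integral_ind2 ?vT ?ltry//; try exact: mTA.
by rewrite -EFinB mulrBl.
Qed.

Let N1 := [set v : 'rV[R]_m.+1 | v 0 ord0 + q (tl v) = 0].
Let N2 := [set v : 'rV[R]_m.+1 | shell (tl v)].

Let mN1 : measurable N1.
Proof.
rewrite (_ : N1 = [set v : 'rV[R]_m.+1 | v 0 ord0 + q (tl v) \in `[0, 0]]); first exact: mpre.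
apply/seteqP; split => v; rewrite /N1 /= in_itv/=; first by move=> ->; rewrite lexx.
by move=> h; apply/eqP; rewrite eq_le andbC.
Qed.

Let mN2 : measurable N2.
Proof.
apply: mtlK1; apply: measurableD => //; apply: bigcup_measurable => k _.
have mf : measurable_fun setT (fun v : 'rV[R]_m => (1 + k.+1%:R^-1) *: v).
  by under eq_fun do rewrite -mul_mx_scalar; exact: measurable_fun_linear_rV.
by rewrite -[X in measurable X]setTI; exact: mf.
Qed.

Let null1 : L N1 = 0%E.
Proof.
rewrite sections// integral0_eq// => v _.
rewrite (_ : mkset _ = [set - q v]) ?lebesgue_measure_set1//.
apply/seteqP; split => s; rewrite /N1 /= tl_cons rV_cons0; first by move=> /eqP; rewrite addr_eq0 => /eqP.
by move=> ->; rewrite addNr.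
Qed.

Let null2 : L N2 = 0%E.
Proof.
have mshell : measurable shell.
  apply: measurableD => //; apply: bigcup_measurable => k _.
  have mf : measurable_fun setT (fun v : 'rV[R]_m => (1 + k.+1%:R^-1) *: v).
    by under eq_fun do rewrite -mul_mx_scalar; exact: measurable_fun_linear_rV.
  by rewrite -[X in measurable X]setTI; exact: mf.
rewrite /L /= /lebesgue_succ /pushforward (_ : _ @^-1` _ = setT `*` shell).
  rewrite product_measure1E//; transitivity (@lebesgue_measure R setT * 0)%E; last exact: mule0.
  by congr (_ * _)%E; exact: shell0.
by apply/seteqP; split => -[s v]; rewrite /N2 /= tl_cons; [split|case].
Qed.

Lemma layer_cvg : (fine (L (K `&` P r)) - fine (L (K `&` half_space u))) / r @[r --> 0^'+] -->
  fine (\int[lebesgue_rV R m]_(v in K1) (q v)%:E)%E.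
Proof.
(* Dominated convergence wants the bound for every index, while a sequence tending to 0 is below
   [r0] only eventually; it is replaced below by its minimum with r0 / 2. *)
suff seq_cvg (a : R^nat) : (forall n, 0 < a n < r0) -> a @ \oo --> (0 : R) ->
    ((fine (L (K `&` P (a n))) - fine (L (K `&` H))) / a n)%:E @[n --> \oo] -->
    (\int[lebesgue_rV R m]_(v in K1) (q v)%:E)%E.
  apply/cvg_at_rightP => a [a0 ca].
  pose b n := Num.min (a n) (r0 / 2).
  have r02 : 0 < r0 / 2 by rewrite divr_gt0.
  have b0 n : 0 < b n < r0.
    rewrite lt_min a0 r02 /= gt_min; apply/orP; right.
    by rewrite ltr_pdivrMr// mulr_natr mulr2n ltrDl.
  have ab : \forall n \near \oo, b n = a n.
    have : \forall n \near \oo, a n < r0 / 2 by exact: (@cvgr_lt _ _ _ _ a _ ca _ r02).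
    by apply: filterS => n an; rewrite /b min_l// ltW.
  have cb : b @ \oo --> (0 : R).
    by apply: cvg_trans ca; apply: near_eq_cvg; apply: filterS ab => n ->.
  have fI : (\int[lebesgue_rV R m]_(v in K1) (q v)%:E)%E \is a fin_num.
    by rewrite -integral_g integral_ind2// fin_numB !ge0_fin_numE// LPP LQQ.
  have h := seq_cvg b b0 cb; rewrite -(fineK fI) in h; have {}h := fine_cvg h.
  apply: (@cvg_trans _ ((fine (L (K `&` P (b n))) - fine (L (K `&` H))) / b n @[n --> \oo])); last exact: h.
  by apply: near_eq_cvg; apply: filterS ab => n ->.
move=> a0 ca.
have [] := @dominated_convergence _ _ _ L setT measurableT (fun n v => (f (a n) v)%:E)
  (fun v => (g v)%:E) (fun v => (\1_B v)%:E).
- move=> n; apply/measurable_EFinP; apply: measurable_funB; apply: measurable_indic;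
    by apply: mTA; exact: measurableI.
- by apply/measurable_EFinP; apply: measurable_funB; exact: measurable_indic.
(* The null set off which [near_f] gives pointwise convergence. *)
- exists (N1 `|` N2); split.
  + exact: measurableU.
  + apply/eqP; rewrite eq_le measure_ge0 andbT.
    by apply: le_trans (measureU2 L mN1 mN2) _; rewrite -[X in (X + _)%E]/(L N1) -[X in (_ + X)%E]/(L N2) null1 null2 adde0.
  + move=> v /= h; apply: contrapT => /not_orP[n1 n2]; apply: h => _.
    have hv : \forall r \near 0^'+, f r v = g v by apply: near_f => //; exact/eqP.
    have /near0_rightP[r r1 hr] := hv.
    have fg : (f (a n) v)%:E @[n --> \oo] --> (g v)%:E.
      apply: cvg_near_cst.
      have : \forall n \near \oo, a n < r by exact: (@cvgr_lt _ _ _ _ a _ ca _ r1).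
      by apply: filterS => n an; rewrite hr//; have /andP[] := a0 n.
    exact: fg.
- exact: integrable_ind.
- by apply: aeW => v n _; rewrite /= lee_fin; exact: f_le.
move=> _ _; rewrite integral_g => h; apply: cvg_trans h; apply: near_eq_cvg; apply: nearW => n.
by apply: integral_f; have /andP[] := a0 n.
Qed.
End layer.

(** * Rescaling, moments and conclusion *)

Lemma measurable_affine_preimage (R : realType) n (G : set 'rV[R]_n) (x : 'rV[R]_n) (r : R) :
  measurable G -> measurable [set y | G (x + r *: y)].
Proof.
move=> mG; have mf : measurable_fun setT (fun y : 'rV[R]_n => y *m r%:M + x).
  exact: (measurableT_comp (measurable_fun_addr x) (measurable_fun_linear_rV _)).
rewrite (_ : mkset _ = (fun y : 'rV[R]_n => y *m r%:M + x) @^-1` G).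
  by rewrite -[X in measurable X]setTI; exact: mf.
by apply/seteqP; split => y /=; rewrite mul_mx_scalar addrC.
Qed.

(** Translation and dilation carry x + r K back to [K]; both volumes acquire the factor r ^ n, which
    cancels. *)
Lemma delta_scaled (R : realType) n (K G : set 'rV[R]_n) (x : 'rV[R]_n) (r : R) : 0 < r ->
  measurable K -> measurable G ->
  delta K G x r = vol (K `&` [set y | G (x + r *: y)]) / vol K.
Proof.
move=> r0 mK mG; have r1 : r != 0 by rewrite gt_eqF.
have mA : measurable (K `&` [set y | G (x + r *: y)]).
  by apply: measurableI => //; exact: measurable_affine_preimage.
have volS (A : set 'rV[R]_n) : measurable A -> vol [set r *: y | y in A] = r ^+ n * vol A.
  move=> mA'; rewrite /vol lebesgue_rV_scale//.
  (* For infinite measure, [vol] takes the default value 0 on both sides. *)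
  have [Aoo|Aoo] := eqVneq (lebesgue_rV R n A) +oo%E; last first.
    by rewrite fineM// ge0_fin_numE// ltey.
  by rewrite Aoo gt0_muley ?lte_fin ?exprn_gt0//= mulr0.
have mS : measurable [set r *: y | y in K `&` [set y | G (x + r *: y)]].
  have mf : measurable_fun setT (fun y : 'rV[R]_n => y *m r^-1%:M).
    exact: measurable_fun_linear_rV.
  rewrite (_ : image _ _ = (fun y : 'rV[R]_n => y *m r^-1%:M) @^-1` (K `&` [set y | G (x + r *: y)])).
    by rewrite -[X in measurable X]setTI; exact: mf.
  apply/seteqP; split => [_ [y h <-]|y h] /=.
    by rewrite mul_mx_scalar scalerA mulVf// scale1r.
  exists (y *m r^-1%:M) => //; by rewrite mul_mx_scalar scalerA mulfV// scale1r.
rewrite /delta volS//.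
have -> : vol (G `&` [set x + r *: y | y in K]) = r ^+ n * vol (K `&` [set y | G (x + r *: y)]).
  rewrite -volS// /vol -[in RHS](lebesgue_rV_shift (- x) mS); congr (fine (lebesgue_rV R n _)).
  apply/seteqP; split => [z [Gz [y Ky yz]]|z [y [Ky Gy] yz]] /=.
    by exists y; [split => //=; rewrite yz|rewrite -yz addrC addKr].
  have zE : x + r *: y = z by rewrite yz addrC subrK.
  by split; [rewrite -zE|exists y].
by rewrite invfM mulrACA mulfV ?mul1r// expf_neq0.
Qed.

Lemma integral_quadratic (R : realType) m (A : set 'rV[R]_m) (M : R) (c : 'I_m -> R) : measurable A ->
  (forall v, A v -> forall i, `|v 0 i| <= M) ->
  fine (\int[lebesgue_rV R m]_(v in A) (\sum_i c i * v 0 i ^+ 2)%:E)%E =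
  \sum_i c i * fine (\int[lebesgue_rV R m]_(v in A) (v 0 i ^+ 2)%:E)%E.
Proof.
move=> mA AM; have Aoo := lebesgue_rV_bounded mA AM.
have mi i : measurable_fun setT (fun v : 'rV[R]_m => v 0 i ^+ 2).
  by apply: measurable_funX; exact: measurable_rV_coord.
have int i : (lebesgue_rV R m).-integrable A (EFin \o (fun v : 'rV[R]_m => v 0 i ^+ 2)).
  apply: measurable_bounded_integrable => //; first exact: measurable_funS (mi i).
  exists (M ^+ 2); split; first exact: num_real.
  move=> y My v Av /=; rewrite (le_trans _ (ltW My))// normrX lerXn2r ?nnegrE//.
    by rewrite (le_trans (normr_ge0 (v 0 i)))// AM.
  exact: AM.
have -> : (\int[lebesgue_rV R m]_(v in A) (\sum_i c i * v 0 i ^+ 2)%:E =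
    \sum_i ((c i)%:E * \int[lebesgue_rV R m]_(v in A) (v 0%R i ^+ 2)%:E))%E.
  under eq_integral do rewrite -sumEFin.
  rewrite integral_sum//; last first.
    move=> i; have := integrableZl mA (c i) (int i).
    by apply: eq_integrable => // v _; rewrite /= EFinM.
  apply: eq_bigr => i _; rewrite -integralZl//; last exact: int.
have fi i : (\int[lebesgue_rV R m]_(v in A) (v 0%R i ^+ 2)%:E)%E \is a fin_num.
  exact: (integrable_fin_num mA (int i)).
rewrite -sum_fine; last by move=> i _; rewrite fin_numM.
by apply: eq_bigr => i _; rewrite fineM.
Qed.

Lemma expansion_of_cvg (R : realType) (d : R -> R) (a b : R) :
  (d r - a) / r @[r --> 0^'+] --> - b -> d = (fun r => a - b * r) +o_ (0^'+) id.
Proof.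
move=> h; apply/eqaddoP => eps e0.
have /cvgrPdist_le/(_ _ e0)/near0_rightP[r r0 hr] := h.
apply/near0_rightP; exists r => // t t0 tr; have := hr _ t0 tr.
rewrite -[(d - _) t]/(d t - (a - b * t)) distrC opprK => ht.
rewrite -[X in _ <= X]/(eps * `|t|) -ler_pdivrMr ?normr_gt0 ?gt_eqF// -normfV -normrM.
by apply: le_trans ht; rewrite le_eqVlt; apply/orP; left; apply/eqP; congr `|_|; field; rewrite gt_eqF.
Qed.

Theorem theorem3p4 (R : realType) (N : nat) (hN : (2 <= N)%N)
    (K G : set 'rV[R]_N) (x : 'rV[R]_N)
    (kappa : 'I_N.-1 -> R) (e : 'I_N.-1 -> 'rV[R]_N)
    (hK : convex_body K) (hK0 : K° 0)
    (hG : convex_body G) (hG2 : C2_boundary G) (hx : boundary G x)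
    (hke : principal_curvatures_directions G x kappa e) :
  ((delta K G x r - delta0 K G x) / r @[r --> 0^'+]
    --> - (1 / (2 * vol K)) * \sum_i moment K G x (e i) * kappa i) /\
  delta K G x =
    (fun r => delta0 K G x - delta1 K G x kappa e * r) +o_ (0^'+) id.
Proof.
suff lim : (delta K G x r - delta0 K G x) / r @[r --> 0^'+] -->
    - (1 / (2 * vol K)) * \sum_i moment K G x (e i) * kappa i.
  split => //; apply: (@expansion_of_cvg _ (delta K G x) (delta0 K G x) (delta1 K G x kappa e)).
  have E : - (1 / (2 * vol K)) * \sum_i moment K G x (e i) * kappa i = - delta1 K G x kappa e.
    by rewrite mulNr.
  by rewrite -E; exact: lim.
case: N hN K G x kappa e hK hK0 hG hG2 hx hke => [//|m] m0 K G x kappa e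
  [cK convK _] K0 [cG _ _] hG2 hx hke.
(* N >= 2 becomes 0 < m, the range in which the Hausdorff measure of dimension m = N - 1 is compared
   with Lebesgue measure. *)
rewrite ltnS in m0.
have clK : closed K by apply: compact_closed => //; exact: norm_hausdorff.
have clG : closed G by apply: compact_closed => //; exact: norm_hausdorff.
have mK : measurable K by exact: closed_measurable_rV.
have mG : measurable G by exact: closed_measurable_rV.
have [M KM] : exists M : R, forall y, K y -> `|y| <= M.
  have [M [_ hM]] := compact_bounded cK; exists (M + 1) => y Ky.
  by apply: (hM (M + 1)) => //; rewrite ltrDl.
(* Compactness bounds the sup norm; the Euclidean norm is at most m+1 times larger. *)
pose M' := m.+1%:R * M.
have KM' y : K y -> enorm y <= M'.
  move=> /KM yM; apply: enorm_le_coord => // i; exact: le_trans (coord_le_norm _ _) yM.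
have [w [C [r0 [r00 C0 hw hq [nu1 nue]]]]] := boundary_expansion KM clG hG2 hx hke.
have [_ ee _] := hke.
pose q (v : 'rV[R]_m) := \sum_i (- kappa i / 2) * v 0 i ^+ 2.
have qE (v : 'rV[R]_m) : - (\sum_i kappa i * v 0 i ^+ 2) / 2 = q v.
  by rewrite mulNr mulr_suml -sumrN; apply: eq_bigr => i _; ring.
have mq : measurable_fun setT q.
  apply: measurable_sum => i; apply: measurable_funM => //.
  by apply: measurable_funX; exact: measurable_rV_coord.
have mP (r : R) : measurable [set y | G (x + r *: y)] by exact: measurable_affine_preimage.
have hq' s v : w r ((r * s) *: nu G x + frame e v) @[r --> 0^'+] --> q v.
  by rewrite -qE; exact: hq.
have lc := layer_cvg nu1 nue ee clK convK K0 KM' r00 mP hw hq' mq.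
pose A := frame e @^-1` K.
have mA : measurable A by rewrite -[X in measurable X]setTI; exact: measurable_frame.
have AM v : A v -> forall i, `|v 0 i| <= M'.
  by move=> /KM'; rewrite (enorm_frame ee) => vM i; exact: le_trans (coord_le_enorm _ _) vM.
have momE i : moment K G x (e i) = fine (\int[lebesgue_rV R m]_(v in A) (v 0 i ^+ 2)%:E)%E.
  have minn : measurable_fun setT (fun v : 'rV[R]_m.+1 => inner v (e i)).
    by apply: measurable_inner => //; exact: measurable_cst.
  have minu : measurable_fun setT (fun v : 'rV[R]_m.+1 => inner v (nu G x)).
    by apply: measurable_inner => //; exact: measurable_cst.
  have mH : measurable (hyperplane (nu G x)).
    rewrite (_ : hyperplane _ = (fun v => inner v (nu G x)) @^-1` [set 0]); last by [].
    by rewrite -[X in measurable X]setTI; apply: minu => //; exact: measurable_set1.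
  rewrite /moment (integral_hausdorff_hyperplane nu1 nue ee (M := M'))//.
  - have -> : frame e @^-1` (K `&` hyperplane (nu G x)) = A.
      apply/seteqP; split => v; first by case.
      by move=> Av; split => //; rewrite /hyperplane /= inner_frameu.
    by congr fine; apply: eq_integral => v _; rewrite inner_frame.
  - exact: measurableI.
  - by move=> v [/KM'].
  - apply/measurable_EFinP; apply: measurable_funX; exact: measurable_funS minn.
  - by move=> v _; rewrite lee_fin sqr_ge0.
rewrite (integral_quadratic (fun i => - kappa i / 2) mA AM) in lc.
have -> : - (1 / (2 * vol K)) * \sum_i moment K G x (e i) * kappa i =
    (\sum_i - kappa i / 2 * fine (\int[lebesgue_rV R m]_(v in A) (v 0 i ^+ 2)%:E)%E) * (vol K)^-1.
  rewrite mulr_sumr mulr_suml; apply: eq_bigr => i _; by rewrite momE invfM; ring.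
apply: cvg_trans (cvgM lc (cvg_cst (vol K)^-1)).
apply: near_eq_cvg; apply/near0_rightP; exists 1 => // r r1 _ /=.
(* Both densities have the denominator [vol K], which [layer_cvg] does not contain and which enters
   as a constant factor of the limit. *)
rewrite delta_scaled// /delta0 -mulrBl mulrAC.
by [].
Qed.
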